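(* Let $S:I\to I$, $I=[0,1)$, be an interval translation map and let $\mu$ be a non-atomic $S$-invariant Borel probability measure. Put $J=\operatorname{supp}\mu$, let $h(x)=\mu([0,x])$ be the distribution coordinate, let $T=h\circ S\circ h^{-1}$ denote the induced map (modulo the full-measure sets on which this expression is defined), and let $\mathcal C_{\mathrm{def}}\subset[0,1]$ be the canonical defect cut set of $(S,\mu)$. (i) If $\mathcal C_{\mathrm{def}}$ is finite, then the canonical distribution-coordinate model $T$ is a finite interval exchange transformation modulo endpoints. (ii) If $\operatorname{Leb}(\mathcal C_{\mathrm{def}})=0$, then the canonical distribution-coordinate model $T$ is a countable interval exchange transformation modulo Lebesgue-null sets. (iii) Let $\alpha\in(0,1/2)$ be the root of $x^3-x^2-2x+1=0$, put $\beta=\alpha^2$ and $q_0=(1-\alpha)^2$, and let $S$ be the stationary Bruin--Troubetzkoy map $$S(x)=\begin{cases}x+\alpha,&x\in[0,1-\alpha),\\ x+\beta,&x\in[1-\alpha,1-\beta),\\ x+\beta-1,&x\in[1-\beta,1),\end{cases}$$ with $\mu$ its unique invariant Borel probability measure. Define, for $r\ge 0$, $$u_r=\alpha(1-q_0^{\,r+1}),\qquad v_r=2\alpha-\beta-(\alpha-\beta)q_0^{\,r+1}.$$ Then $$\mathcal C_{\mathrm{def}}=\{0,1,\alpha,2\alpha-\beta\}\cup\{u_r:r\ge0\}\cup\{v_r:r\ge0\}.$$ This set is countably infinite and Lebesgue-null, and every active-gap cut in the two sequences $(u_r)$, $(v_r)$ is essential. Consequently, the canonical model $T$ is a countable interval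 exchange transformation that cannot be represented by finitely many translation intervals in the distribution coordinate.
   Context: Interval translation map. Let $I=[0,1)$. An interval translation map is a map $S:I\to I$ for which there are $0=t_0<t_1<\dots<t_n=1$ and $c_1,\dots,c_n\in\mathbb R$ such that, with $I_k=[t_{k-1},t_k)$ (the branches), $S(x)=\tau_k(x):=x+c_k\in[0,1)$ for all $x\in I_k$. A measure $\mu$ is $S$-invariant if $\mu(S^{-1}B)=\mu(B)$ for all Borel $B$. The measure $\mu$ is also regarded as a measure on $[0,1]$ with $\mu(\{1\})=0$; $J=\operatorname{supp}\mu$ is a closed subset of $[0,1]$; $h(x)=\mu([0,x])$ for $x\in[0,1]$. $\operatorname{Leb}$ is Lebesgue measure. Induced map $T$. Fix a Borel set $X_0\subset J$ with $\mu(X_0)=1$, $S(X_0)=X_0$, such that $S:X_0\to X_0$ is a measurable bijection with measurable, measure-preserving inverse (such a set exists for every interval translation map and every non-atomic invariant probability). Let $E_0$ be the countable set consisting of $t_0,\dots,t_n$ and of all endpoints of connected components of $[0,1]\setminus J$, and put $X=X_0\setminus\bigcup_{m\in\mathbb Z}S^m(E_0\cap X_0)$, where $S^m$ refers to the bijection $S:X_0\to X_0$. Then $h$ is injective on $X$ and $Y=h(X)$ has full Lebesgue measure; let $q:Y\to X$ be the inverse of $h:X\to Y$. Define $T(u)=h(S(q(u)))$ for $u\in Y$, and $T(u)=u_*$, a fixed point of $[0,1]$, for $u\notin Y$. This $T$ is the canonical distribution-coordinate model. Canonical defect cut set. For Borel $B\subset I_k$ put $\sigma_k(B)=\mu(\tau_k(B))-\mu(B)$;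 this is a finite positive Borel measure on $I_k$. For Borel $E\subset[0,1]$ put $\rho_k(E)=\sigma_k(h^{-1}(E)\cap I_k)$. Then $$\mathcal C_{\mathrm{def}}=\{h(t_0),\dots,h(t_n)\}\cup\bigcup_{k=1}^n\operatorname{supp}\rho_k\subset[0,1].$$ Active gaps. A branchwise gap in $I_k$ is a connected component $G=(a,b)$ of $(t_{k-1},t_k)\setminus J$; it is active if $\mu(\tau_k(G))>0$; its active-gap cut is the value $h(G):=h(a)=h(b)$. A cut $c\in(0,1)$ is essential if no neighborhood of $c$ carries a single translation representative of $T$ almost everywhere, i.e. there are no neighborhood $V$ of $c$ and constant $d$ with $T(u)=u+d$ for Lebesgue-a.e. $u\in V$. Interval exchanges. An interval translation map is a (finite) interval exchange transformation (IET) if it is one-to-one except possibly at branch endpoints; equivalently, the images of its branches are pairwise disjoint modulo Lebesgue-null sets and cover the interval modulo endpoints. ''$T$ is a finite IET modulo endpoints'' means that $T$ agrees with a finite IET after modification on a Lebesgue-null set (and choice of values at the finitely many endpoints). A measurable map $R:[0,1]\to[0,1]$ is a countable IET modulo Lebesgue-null sets if there is a countable family of pairwise disjoint open intervals $U_m$ whose union has full Lebesgue measure, and constants $d_m$, such that $R(u)=u+d_m$ for a.e. $u\in U_m$, while the intervals $U_m+d_m$ are contained in $[0,1]$ up to endpoints, are pairwise disjoint modulo endpoints, and cover $[0,1]$ modulo a null set. ''$T$ cannot be represented by finitely many translation intervals'' means: there is no finite set $F\subset[0,1]$ such that on each connected component of $[0,1]\setminus F$ the map $T$ agrees Lebesgue-a.e.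 with a translation. The map in (iii) has exactly one invariant Borel probability measure, and it is non-atomic. *)

(* Defs.v *)
From HB Require Import structures.
From mathcomp Require Import all_boot all_order all_algebra.
From mathcomp Require Import all_classical all_reals all_analysis.

Set Implicit Arguments.
Unset Strict Implicit.
Unset Printing Implicit Defensive.

Import Order.TTheory GRing.Theory Num.Theory.
Import numFieldNormedType.Exports.

Local Open Scope classical_set_scope.
Local Open Scope ring_scope.

Section interval_translation_maps.
Context {R : realType}.
Implicit Types (S f : R -> R) (n : nat) (t c : nat -> R).

(* Self-maps of [0, 1) are represented by functions R -> R whose values
   outside [0, 1) are irrelevant. Branches are numbered from 0 to n - 1, and
   only t 0, ..., t n and c 0, ..., c (n - 1) matter. *)
Definition unitI : set R := `[0, 1[.

Definition branch t (k : nat) : set R := `[t k, t k.+1[.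

Definition is_ITM n t c S :=
  [/\ t 0%N = 0, t n = 1,
      forall k, (k < n)%N -> t k < t k.+1
    & forall k x, (k < n)%N -> branch t k x ->
        S x = x + c k /\ 0 <= x + c k < 1].

Definition is_IET n t c S :=
  is_ITM n t c S /\
  forall x y, unitI x -> unitI y ->
    (forall k, (k <= n)%N -> x != t k /\ y != t k) ->
    S x = S y -> x = y.

Definition finite_IET_ae f :=
  exists n t c (F : R -> R), is_IET n t c F /\
    {ae lebesgue_measure, forall u : R, unitI u -> f u = F u}.

Definition unitC : set R := `[0, 1].

(* A countable family of open intervals is indexed by nat; finite families are
   covered because `]a m, b m[ is empty when b m <= a m. For open intervals,
   inclusion and disjointness up to endpoints are plain inclusion in [0, 1]
   and plain disjointness. *)
Definition countable_IET f :=
  [/\ measurable_fun unitC f, (forall u, unitC u -> unitC (f u)) &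
    exists a b d : nat -> R,
      let U (m : nat) : set R := `]a m, b m[%classic in
      let V (m : nat) : set R := [set u + d m | u in U m] in
      [/\ trivIset setT U /\ (forall m, U m `<=` unitC),
          lebesgue_measure (unitC `\` \bigcup_m U m) = 0%E,
          (forall m, {ae lebesgue_measure,
            forall u : R, U m u -> f u = u + d m}),
          trivIset setT V /\ (forall m, V m `<=` unitC)
        & lebesgue_measure (unitC `\` \bigcup_m V m) = 0%E]].

Definition finitely_many_translations f :=
  exists F : set R, [/\ finite_set F, F `<=` unitC
    & forall x, (unitC `\` F) x -> exists d : R,
        {ae lebesgue_measure, forall u : R,
           connected_component (unitC `\` F) x u -> f u = u + d}].

Definition essential_cut f (c : R) :=
  0 < c < 1 /\
  ~ exists V d, nbhs c V /\
      {ae lebesgue_measure, forall u : R, V u -> f u = u + d}.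

(* Support of a measure given as a set function; used both for mu and for the
   defect measures rho_k. *)
Definition msupp (nu : set R -> \bar R) : set R :=
  [set x | forall U : set R, open U -> U x -> (0 < nu U)%E].

(* A Borel measure on [0, 1) is a Borel measure on R giving full mass to it. *)
Definition invariant_probability S (mu : probability (measurableTypeR R) R) :=
  mu unitI = 1%E /\
  forall B : set R, measurable B -> mu (unitI `&` S @^-1` B) = mu B.

Definition nonatomic (mu : probability (measurableTypeR R) R) :=
  forall x : R, mu [set x] = 0%E.

Section distribution_coordinate.
Variable mu : probability (measurableTypeR R) R.

Definition distr (x : R) : R := fine (mu `[0, x]%classic).

(* The components of [0, 1] \ supp mu are intervals, with endpoints their
   infimum and supremum. *)
Definition exceptional_set n t : set R :=
  let D := unitC `\` msupp mu in
  [set t k | k in [set k | (k <= n)%N]] `|`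
  [set e | exists x, D x /\
     (e = inf (connected_component D x) \/
      e = sup (connected_component D x))].

Definition bijectivity_domain S (X0 : set R) :=
  [/\ measurable X0 /\ X0 `<=` msupp mu `&` unitI,
      mu X0 = 1%E,
      set_bij X0 X0 S,
      measurable_fun X0 S /\ measurable_fun X0 (pinv X0 S)
    & forall B : set R, measurable B ->
        mu (X0 `&` pinv X0 S @^-1` B) = mu (X0 `&` B)].

(* S^m for the bijection S : X0 -> X0 and m in Z. *)
Definition iterz S (X0 : set R) (m : int) : R -> R :=
  match m with
  | Posz k => iter k S
  | Negz k => iter k.+1 (pinv X0 S)
  end.

Definition good_set n t S (X0 : set R) : set R :=
  X0 `\` \bigcup_(m : int) (iterz S X0 m @` (exceptional_set n t `&` X0)).

Definition canonical_model n t S (X0 : set R) (ustar u : R) : R :=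
  let X := good_set n t S X0 in
  if u \in distr @` X then distr (S (pinv X distr u)) else ustar.

Definition defect_measure (d : R) (B : set R) : \bar R :=
  (mu [set (x + d)%R | x in B] - mu B)%E.

Definition defect_pushforward t c (k : nat) (E : set R) : \bar R :=
  defect_measure (c k) (distr @^-1` E `&` branch t k).

Definition defect_cut_set n t c : set R :=
  [set distr (t k) | k in [set k | (k <= n)%N]] `|`
  \bigcup_(k in [set k | (k < n)%N]) msupp (defect_pushforward t c k).

(* distr is constant on the closure of a gap G, and inf G is its left
   endpoint. *)
Definition active_gap_cut n t c (e : R) :=
  exists k x, let D := `]t k, t k.+1[%classic `\` msupp mu in
    let G := connected_component D x in
    [/\ (k < n)%N, D x, (0 < mu [set (y + c k)%R | y in G])%E
      & e = distr (inf G)].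

End distribution_coordinate.

Definition BT_map (alpha beta : R) (x : R) : R :=
  if x < 1 - alpha then x + alpha
  else if x < 1 - beta then x + beta
  else x + beta - 1.

Definition BT_t (alpha beta : R) : nat -> R :=
  nth 1 [:: 0; 1 - alpha; 1 - beta; 1].

Definition BT_c (alpha beta : R) : nat -> R :=
  nth 0 [:: alpha; beta; beta - 1].

End interval_translation_maps.

(* Main.v *)
(* The distribution function [h] carries [mu] to Lebesgue measure and is strictly
   increasing on the good points, so [T] is injective on a set of full measure.
   At [u = h x] with [x] in the k-th branch, [T u - u = h (x + c k) - h x], and
   the increments of this function are the masses of the defect measure of the
   branch. Hence [T] is a translation on each interval avoiding the defect cut
   set, while it is not one near a point of the support of a pushed-forward
   defect measure that is interior to its branch; injectivity makes the
   translated intervals disjoint.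

   For the stationary Bruin-Troubetzkoy map, the first return map to
   [`[1 - a, 1[] is affinely conjugate to the map itself, so that unique
   ergodicity gives [h (1 - a + a * y) = h (1 - a) + (1 - h (1 - a)) * h y], and
   invariance then forces [h (1 - a) = a]. The resulting functional equations
   show that on the first branch [h (x + a) - h x] varies only across the images
   of the gap [`]b, a[] under the iterates of [z |-> a + b * z], so the defect
   is a sum of point masses at the [u_r]; the second branch is an affine copy
   of the first. *)

Require Import Defs.
From HB Require Import structures.
From mathcomp Require Import all_boot all_order all_algebra.
From mathcomp Require Import all_classical all_reals all_analysis.
From mathcomp Require Import measurable_realfun.
From mathcomp Require Import ring lra.

Set Implicit Arguments.
Unset Strict Implicit.
Unset Printing Implicit Defensive.

Import Order.TTheory GRing.Theory Num.Theory.
Import numFieldNormedType.Exports.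

Local Open Scope classical_set_scope.
Local Open Scope ring_scope.

(** * Distribution and quantile functions *)

(** Two obstacles shape the general half. [T] goes through a choice-made inverse of [h] on the good
    set, and forward images under [h] are not visibly measurable; a monotone generalized inverse
    [quantile], defined everywhere, turns these images into preimages and pushes Lebesgue measure to
    [mu]. The defect is defined as a difference of masses, so neither its positivity nor its
    additivity is apparent; invariance identifies it with the mass that enters the translated branch
    from the other branches. For the stationary map, [h (1 - a) = a] comes out of a cubic:
    [m = 1 - h (1 - a)] satisfies [m ^ 3 - 2 * m ^ 2 - m + 1 = 0], which is the given cubic
    rewritten for [1 - a], and [1 - a] is its only root in []0, 1]]. The ratio of both cut sequences
    is [q = (1 - a) ^ 2] because scaling by [b = a * a] amounts to two zooms by [a], each
    multiplying mass by [1 - a]. It is kept in the form [1 - 2 * a + b] so that most of the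
    arithmetic stays linear. *)

Section distribution_function.
Context {R : realType} (mu : probability (measurableTypeR R) R).
Hypotheses (mu1 : mu unitI = 1%E) (mu_atom : nonatomic mu).
Local Notation h := (distr mu).

Lemma mu_null_sub (A B : set R) : measurable A -> measurable B ->
  A `<=` B -> mu B = 0%E -> mu A = 0%E.
Proof.
move=> mA mB AB B0; apply/eqP; rewrite eq_le measure_ge0 andbT -B0.
by rewrite le_measure ?inE.
Qed.

Lemma mu_setC_unitI : mu (~` unitI) = 0%E.
Proof.
by rewrite probability_setC ?mu1 ?subee//; exact: measurable_itv.
Qed.

Lemma mu_setI_unitI (A : set R) : measurable A -> mu (A `&` unitI) = mu A.
Proof.
move=> mA; have mI : measurable (unitI : set R) by exact: measurable_itv.
rewrite [RHS](_ : _ = mu ((A `&` unitI) `|` (A `&` ~` unitI))); last first.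
  by rewrite -setIUr setUv setIT.
rewrite measureU; [|exact: measurableI|by apply: measurableI => //; exact: measurableC|].
  rewrite [X in (_ = _ + X)%E](mu_null_sub _ _ _ mu_setC_unitI) ?adde0//.
  - by apply: measurableI => //; exact: measurableC.
  - exact: measurableC.
by rewrite setIACA setICr setI0.
Qed.

Lemma distr_cdf (x : R) : mu `]-oo, x]%classic = (h x)%:E.
Proof.
rewrite /distr fineK; last by apply: fin_num_measure; exact: measurable_itv.
rewrite -mu_setI_unitI; last exact: measurable_itv.
rewrite -[RHS]mu_setI_unitI; last exact: measurable_itv.
congr (mu _); apply/seteqP; split => y /=; rewrite /unitI/= !in_itv/=.
  by move=> [-> /andP[-> ->]].
by move=> [/andP[_ ->] ->].
Qed.

Lemma distr_nd : {homo h : x y / x <= y}.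
Proof.
move=> x y xy; rewrite -lee_fin -!distr_cdf le_measure ?inE//=.
move=> z /=; rewrite !in_itv/= => /le_trans; exact.
Qed.

Lemma distr_ge0 (x : R) : 0 <= h x.
Proof. by rewrite -lee_fin -distr_cdf. Qed.

Lemma distr_le1 (x : R) : h x <= 1.
Proof. by rewrite -lee_fin -distr_cdf probability_le1. Qed.

Lemma distr_unitC (x : R) : unitC (h x).
Proof. by rewrite /unitC/= in_itv/= distr_ge0 distr_le1. Qed.

Lemma mu_itvoc (a b : R) : a <= b -> mu `]a, b]%classic = (h b - h a)%:E.
Proof.
move=> ab; rewrite EFinB -!distr_cdf.
rewrite (_ : `]-oo, b]%classic = `]-oo, a] `|` `]a, b]); last first.
  apply/seteqP; split => y /=; rewrite !in_itv/=.
    by case: (leP y a) => //= ya yb; [left|right].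
  by case=> [/le_trans->//|/andP[_]].
rewrite measureU//; last first.
  by apply/seteqP; split => y //=; rewrite !in_itv/= => -[? /andP[]]; rewrite ltNge => /negP.
rewrite addeAC subee ?add0e//; exact: fin_num_measure.
Qed.

Lemma mu_itvcc (a b : R) : a <= b -> mu `[a, b]%classic = (h b - h a)%:E.
Proof.
move=> ab; rewrite -mu_itvoc// -(@setU1itv _ _ _ _ false)// measureU//.
  by rewrite [X in (X + _)%E](mu_atom a) add0e.
by apply/seteqP; split => y //=; rewrite in_itv/= => -[->]; rewrite ltxx.
Qed.

Lemma mu_itvoo (a b : R) : a <= b -> mu `]a, b[%classic = (h b - h a)%:E.
Proof.
rewrite le_eqVlt => /predU1P[->|ab].
  by rewrite set_itvoo0 measure0 subrr.
rewrite -mu_itvoc ?ltW// -(@setUitv1 _ _ _ _ true)// measureU//.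
  by rewrite [X in (_ + X)%E](mu_atom b) adde0.
by apply/seteqP; split => y //=; rewrite in_itv/= => -[/andP[_ yb] yE]; move: yb; rewrite yE ltxx.
Qed.

Lemma mu_itv (a b : R) (b0 b1 : bool) : a <= b ->
  mu [set` Interval (BSide b0 a) (BSide b1 b)] = (h b - h a)%:E.
Proof.
move=> ab; apply/eqP; rewrite eq_le -{1}mu_itvcc// -mu_itvoo//.
apply/andP; split; apply: le_measure; rewrite ?inE => // y;
  rewrite /= !in_itv/= => /andP[ay yb]; apply/andP; split;
  by case: b0 ay; case: b1 yb => //= *; exact: ltW.
Qed.

Lemma distr_le0 (x : R) : x <= 0 -> h x = 0.
Proof.
move=> x0; apply/le_anti; rewrite distr_ge0 andbT (le_trans (distr_nd x0))//.
have := mu_itvcc (lexx 0); rewrite set_itv1 mu_atom subrr.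
by rewrite -lee_fin => _; rewrite /distr set_itv1 mu_atom.
Qed.

Lemma distr_ge1 (x : R) : 1 <= x -> h x = 1.
Proof.
move=> x1; apply/le_anti; rewrite distr_le1/= -lee_fin -distr_cdf -mu1.
apply: le_measure; rewrite ?inE => //; first exact: measurable_itv.
by move=> y /=; rewrite !in_itv/= => /andP[_ /ltW /le_trans]; exact.
Qed.

(** Continuity of [h] in epsilon form: half-open intervals shrinking to [x] lose all their mass, by
    continuity from above and the absence of atoms. *)
Lemma distr_jump (x : R) (e : R) : 0 < e ->
  exists2 d : R, 0 < d & h (x + d) - h (x - d) < e.
Proof.
move=> e0; pose F n : set R := `]x - n.+1%:R^-1, x + n.+1%:R^-1]%classic.
have FE : \bigcap_n F n = [set x].
  apply/seteqP; split => y /=; last first.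
    move=> -> n _; rewrite /F/= in_itv/=.
    by have : 0 < n.+1%:R^-1 :> R by []; move: (_^-1) => z; lra.
  move=> yF; apply/eqP; rewrite -subr_eq0 -normr_le0 leNgt; apply/negP => yx.
  have /= := yF (Num.truncn (`|y - x|^-1)) I.
  rewrite /F/= in_itv/=.
  have : (Num.truncn `|y - x|^-1).+1%:R^-1 < `|y - x|.
    rewrite invf_plt ?posrE//; exact: Num.Theory.truncnS_gt.
  move: (_.+1%:R^-1) => z; case: (ger0P (y - x)) => ? ? /andP[? ?]; lra.
have : (mu \o F) n @[n --> \oo] --> mu (\bigcap_n F n).
  apply: nonincreasing_cvg_mu => //=.
  - by rewrite (le_lt_trans (probability_le1 _ _)) ?ltry//; exact: measurable_itv.
  - by move=> i; exact: measurable_itv.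
  - by rewrite FE; exact: measurable_set1.
  - move=> m n mn; apply/subsetPset => y; rewrite /F /= !in_itv/=.
    have : n.+1%:R^-1 <= m.+1%:R^-1 :> R by rewrite lef_pV2 ?posrE// ler_nat.
    move: (_^-1) (_^-1) => z z'; lra.
rewrite FE mu_atom => /fine_cvgP[_ /cvgrPdist_lt/(_ _ e0)[n _ /(_ n)]] /=.
rewrite leqnn => /(_ isT).
have n0 : 0 < n.+1%:R^-1 :> R by [].
rewrite /F; move: (_.+1%:R^-1) n0 => z z0; rewrite mu_itvoc; last by lra.
rewrite sub0r normrN => /(le_lt_trans (ler_norm _)) ?.
by exists z.
Qed.

Lemma distr_measurable : measurable_fun setT h.
Proof. by apply: nondecreasing_measurable => //; exact: distr_nd. Qed.

End distribution_function.

Lemma lebesgue_measure_translate {R : realType} (d : R) (A : set R) :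
  measurable A -> lebesgue_measure [set x | A (x + d)] = lebesgue_measure A.
Proof.
move=> mA; pose f (x : measurableTypeR R) : measurableTypeR R := x + d.
have mf : measurable_fun setT f.
  by apply: nondecreasing_measurable => // x y; rewrite lerD2r.
transitivity (pushforward lebesgue_measure f A); first by [].
pose nu : measure (measurableTypeR R) R := pushforward lebesgue_measure f.
rewrite -[LHS]/(nu mf A); apply/esym/lebesgue_measure_unique => // _ [[a b] _ <-] /=.
rewrite /pushforward (_ : f @^-1` _ = `]a - d, b - d]%classic).
  rewrite !lebesgue_measure_itv/= !lte_fin ltrD2r; case: ifP => //.
  by rewrite -!EFinB opprB addrA subrK.
by apply/seteqP; split => x /=; rewrite !in_itv/= /f ltrBlDr lerBrDr.
Qed.

Section quantile.
Context {R : realType} (mu : probability (measurableTypeR R) R).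
Hypotheses (mu1 : mu unitI = 1%E) (mu_atom : nonatomic mu).
Local Notation h := (distr mu).

(** The generalized inverse of [h]. Capping [u] at 1 keeps the set nonempty and [0 <= x] keeps it
    bounded below, so that the function is monotone, hence measurable, on the whole line. *)
Definition quantile (u : R) : R := inf [set x | 0 <= x /\ Num.min u 1 <= h x].

Let quantile_set0 u : [set x | 0 <= x /\ Num.min u 1 <= h x] !=set0.
Proof. by exists 1 => /=; rewrite (distr_ge1 mu1)// ge_min lexx orbT. Qed.

Let quantile_lbound u : lbound [set x | 0 <= x /\ Num.min u 1 <= h x] 0.
Proof. by move=> x []. Qed.

Let quantile_has_inf u : has_inf [set x | 0 <= x /\ Num.min u 1 <= h x].
Proof. by split; [exact: quantile_set0|exists 0; exact: quantile_lbound]. Qed.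

Lemma quantile_ge0 (u : R) : 0 <= quantile u.
Proof. exact: lb_le_inf. Qed.

Lemma quantile_nd : {homo quantile : u v / u <= v}.
Proof.
move=> u v uv; apply: lb_le_inf => // x [x0 vx]; apply: ge_inf.
  exact: (quantile_has_inf u).2.
by split => //; apply: le_trans vx; rewrite le_min2.
Qed.

Lemma quantile_measurable : measurable_fun setT quantile.
Proof. by apply: nondecreasing_measurable => //; exact: quantile_nd. Qed.

Let le_distr_quantile (u : R) : 0 < u <= 1 -> u <= h (quantile u).
Proof.
move=> /andP[u0 u1]; rewrite leNgt; apply/negP => hu.
have [d d0 hd] := distr_jump mu1 mu_atom (quantile u) (e := u - h (quantile u)) ltac:(lra).
have [x [x0 ux] xd] : exists2 x, 0 <= x /\ Num.min u 1 <= h x & x < quantile u + d.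
  exact: (inf_adherent d0 (quantile_has_inf u)).
have : h x <= h (quantile u + d) by apply: (distr_nd mu1); exact: ltW.
have : h (quantile u - d) <= h (quantile u) by apply: (distr_nd mu1); lra.
by move: ux; rewrite (min_idPl u1); lra.
Qed.

(** The Galois connection between [quantile] and [h]. It breaks at [u = 0], where [quantile] is 0
    although [h] vanishes on all negative numbers; hence the interval []0, 1]] in what follows. *)
Lemma quantile_le (u x : R) : 0 < u <= 1 -> (quantile u <= x) = (u <= h x).
Proof.
move=> u01; apply/idP/idP => [ux|ux].
  by rewrite (le_trans (le_distr_quantile u01))// (distr_nd mu1).
case/andP: u01 => u0 u1; apply: ge_inf; first exact: (quantile_has_inf u).2.
split; last by rewrite (min_idPl u1).
rewrite leNgt; apply/negP => x0.
by move: ux; rewrite (distr_le0 mu1 mu_atom (ltW x0)) leNgt u0.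
Qed.

Lemma distr_quantile (u : R) : 0 < u <= 1 -> h (quantile u) = u.
Proof.
move=> u01; apply/eqP; rewrite eq_le le_distr_quantile// andbT leNgt; apply/negP => hu.
have [d d0 hd] := distr_jump mu1 mu_atom (quantile u) (e := h (quantile u) - u) ltac:(lra).
have : h (quantile u) <= h (quantile u + d) by apply: (distr_nd mu1); lra.
have : ~~ (quantile u <= quantile u - d) by rewrite -ltNge; lra.
by rewrite quantile_le// -ltNge; lra.
Qed.

(** Both sides are measures in [A], so half-open intervals suffice, and there the Galois connection
    turns [quantile u] in []a, b]] into [u] in []h a, h b]]. *)
Lemma mu_quantile (A : set R) : measurable A ->
  mu A = lebesgue_measure (quantile @^-1` A `&` `]0, 1]).
Proof.
have mI : measurable (`]0, 1] : set (measurableTypeR R)) by exact: measurable_itv.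
pose q : measurableTypeR R -> measurableTypeR R := quantile.
have mq : measurable_fun setT q := quantile_measurable.
move=> mA; pose nu : measure (measurableTypeR R) R := pushforward (mrestr lebesgue_measure mI) q.
rewrite -[RHS]/(nu mq A).
apply: (@measure_unique _ _ (measurableTypeR R) (@ocitv R)
  (fun k => `](- k%:R), k%:R]%classic) _ _ _ _ mu (nu mq)) => //.
- exact: ocitvI.
- by move=> i; exact: is_ocitv.
- apply/seteqP; split => // x _; exists (Num.Def.trunc `|x|).+1 => //=.
  have := truncnS_gt `|x|; move: (_.+1%:R) => z; rewrite in_itv/=.
  by rewrite ltr_norml => /andP[-> /ltW].
- move=> _ [[a b] _ <-] /=; have [ba|/ltW ab] := leP b a.
    by rewrite set_itv_ge ?bnd_simp -?leNgt// !measure0.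
  rewrite (mu_itvoc mu1)// /pushforward /mrestr.
  rewrite (_ : _ `&` _ = `]h a, h b]%classic).
    rewrite lebesgue_measure_itv/= lte_fin.
    case: ltP => // hba; congr EFin; apply/eqP; rewrite subr_eq0 eq_le hba.
    exact: distr_nd.
  apply/seteqP; split => u /=; rewrite !in_itv/= /q.
    by move=> [/andP[au ub] u01]; rewrite ltNge -quantile_le// -ltNge au -quantile_le.
  move=> /andP[au ub]; have u01 : 0 < u <= 1.
    by rewrite (le_lt_trans (distr_ge0 mu1 a) au) (le_trans ub (distr_le1 mu1 b)).
  by rewrite ltNge !quantile_le// -ltNge au.
- by move=> k; rewrite (le_lt_trans (probability_le1 _ _)) ?ltry//; exact: measurable_itv.
Qed.

(** Strict increase of [h] on the left of the points of [A] forces [quantile (h x) = x]. The image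
    becomes a preimage, which is how its measurability is obtained. *)
Lemma distr_image (A : set R) :
  (forall x z, A x -> 0 <= z < x -> h z < h x) -> (A `<=` `]0, 1]) ->
  h @` A = `]0, 1] `&` quantile @^-1` A.
Proof.
move=> Ainc A01; apply/seteqP; split => [_ [x Ax <-]|u [/= u01 Au]]; last first.
  by exists (quantile u) => //; rewrite distr_quantile.
have /andP[x0 x1] : 0 < x <= 1 by have := A01 _ Ax; rewrite /= in_itv.
have hx01 : 0 < h x <= 1.
  by rewrite (distr_le1 mu1) -(distr_le0 mu1 mu_atom (lexx 0)) Ainc// lexx.
split => //=; rewrite (_ : quantile _ = x)//; apply/eqP; rewrite eq_le quantile_le// lexx/=.
rewrite leNgt; apply/negP => qx.
have := Ainc x (quantile (h x)) Ax; rewrite quantile_ge0 qx distr_quantile// ltxx.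
by move=> /(_ isT).
Qed.

End quantile.

(** * Supports, null sets and components of open sets on the line *)

Lemma nbhs_itvoo {R : realType} (x : R) (U : set R) : nbhs x U ->
  exists2 e : R, 0 < e & `]x - e, x + e[%classic `<=` U.
Proof.
move=> /nbhs_ballP[e /= e0 eU]; exists e => // y yx; apply: eU.
rewrite /ball/= ltr_distl; move: yx; rewrite /= in_itv/= ; lra.
Qed.

Lemma open_itvoo {R : realType} (a b : R) : open (`]a, b[%classic : set R).
Proof. exact: interval_open. Qed.

Lemma open_rat_itv {R : realType} (x : R) (U : set R) : open U -> U x ->
  exists p q : rat, `]ratr p, ratr q[%classic x /\ `]ratr p, ratr q[%classic `<=` U.
Proof.
move=> oU Ux; have [e e0 eU] := nbhs_itvoo (open_nbhs_nbhs (conj oU Ux)).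
have [p] := @rat_in_itvoo R (x - e) x ltac:(lra).
have [q] := @rat_in_itvoo R x (x + e) ltac:(lra).
rewrite !in_itv/= => /andP[q1 q2] /andP[p1 p2].
exists p, q; split => [|y]; rewrite /= in_itv/= ?p2//.
by move=> /andP[py yq]; apply: eU; rewrite /= in_itv/= (lt_trans p1 py) (lt_trans yq).
Qed.

(** A Lindelof argument: every point of [U] off the support lies in a null interval with rational
    ends inside [U], and these intervals are countably many. The properties of [nu] are assumed on
    open sets only, so that the lemma serves [mu] and the defect set functions alike. *)
Lemma open_off_msupp {R : realType} (nu : set R -> \bar R) (U : set R) :
  nu set0 = 0%E ->
  (forall A B : set R, open A -> open B -> A `<=` B -> nu B = 0%E -> (nu A <= 0)%E) ->
  (forall A, open A -> (0 <= nu A)%E) ->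
  (forall F : nat -> set R, (forall i, open (F i)) -> (forall i, nu (F i) = 0%E) ->
    nu (\bigcup_i F i) = 0%E) ->
  open U -> U `&` msupp nu = set0 -> nu U = 0%E.
Proof.
move=> nu0 numono nuge0 nubig oU Unu.
pose I (p : rat * rat) : set R := `]ratr p.1, ratr p.2[%classic.
have oI p : open (I p) by exact: open_itvoo.
pose F n := if unpickle n is Some p then
  if `[< I p `<=` U /\ nu (I p) = 0%E >] then I p else set0 else set0.
rewrite (_ : U = \bigcup_i F i); first apply: nubig => i.
- by rewrite /F; case: unpickle => [p|]; [case: asboolP => _|]; rewrite ?open0//.
- by rewrite /F; case: unpickle => [p|] //; case: asboolP => // -[].
apply/seteqP; split => [x Ux|x [n _]]; last first.
  by rewrite /F; case: unpickle => [p|//]; case: asboolP => // -[+ _]; apply.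
have /existsNP[V /not_implyP[oV /not_implyP[Vx /negP]]] : ~ msupp nu x.
  by move=> xs; have : (U `&` msupp nu) x by []; rewrite Unu.
rewrite -leNgt => Vle0.
have V0 : nu V = 0%E by apply/eqP; rewrite eq_le Vle0 nuge0.
have [p [q [pqx pqUV]]] := open_rat_itv (openI oU oV) (conj Ux Vx).
have [n nE] : exists n, unpickle n = Some (p, q) by exists (pickle (p, q)); exact: pickleK.
exists n => //; rewrite /F nE; case: asboolP => // -[]; split.
  by move=> y /pqUV[].
apply/eqP; rewrite eq_le nuge0// andbT; apply: numono V0 => //.
by move=> y /pqUV[].
Qed.

Lemma closed_msupp {R : realType} (nu : set R -> \bar R) : closed (msupp nu).
Proof.
rewrite -openC openE => x /existsNP[V /not_implyP[oV /not_implyP[Vx nV]]].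
apply: filterS (open_nbhs_nbhs (conj oV Vx)).
by move=> y Vy ys; apply: nV; exact: ys.
Qed.

Lemma null_bigcup {d} {T : measurableType d} {R : realType}
    (nu : measure T R) (F : nat -> set T) :
  (forall i, measurable (F i)) -> (forall i, nu (F i) = 0%E) ->
  nu (\bigcup_i F i) = 0%E.
Proof.
move=> mF F0; apply/negligibleP; first exact: bigcupT_measurable.
by apply: negligible_bigcup => k; apply/negligibleP; [exact: mF|exact: F0].
Qed.

Lemma null_countable {R : realType} (nu : measure (measurableTypeR R) R) (A : set R) :
  (forall x : R, nu [set x] = 0%E) -> countable A -> nu A = 0%E.
Proof.
move=> nu0 cA.
have mA : measurable (A : set (measurableTypeR R)).
  by apply: countable_measurable => // x; exact: measurable_set1.
have /pfcard_geP[->|[f]] := cA; first exact: measure0.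
apply/eqP; rewrite eq_le measure_ge0 andbT.
rewrite -(@null_bigcup _ _ _ nu (fun n => [set f n])) => [|i|i]; last 2 first.
- exact: measurable_set1.
- exact: nu0.
rewrite le_measure ?inE//.
  by apply: bigcupT_measurable => i; exact: measurable_set1.
by move=> x /(@surj _ _ _ _ f)[n _ <-]; exists n.
Qed.

(** Every component contains a nondegenerate interval, hence a rational that determines it. With [f]
    the infimum or the supremum this counts the endpoints of the gaps. *)
Lemma countable_components {R : realType} (J : set R) (f : set R -> R) :
  closed J ->
  countable [set e | exists x, (unitC `\` J) x /\ e = f (connected_component (unitC `\` J) x)].
Proof.
move=> cJ; set D := unitC `\` J.
apply: (@sub_countable _ _ _
  [set f (connected_component D (ratr q)) | q in [set: rat]]); last first.
  by apply: sub_countable (card_image_le _ _) _; exact: countableP.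
apply: subset_card_le => e [x [[x01 nJx] ->]].
have [r r0 rJ] : exists2 r : R, 0 < r & `]x - r, x + r[%classic `<=` ~` J.
  by apply/nbhs_itvoo/open_nbhs_nbhs; split => //; exact/closed_openC.
have [a [b [ab abD abx]]] : exists a b, [/\ a < b, `[a, b]%classic `<=` D & a <= x <= b].
  move: x01; rewrite /unitC/= in_itv/= => x01.
  (* The clipping covers [x = 0] and [x = 1], where only a one-sided neighbourhood lies in [unitC];
     halving [r] puts the closed interval inside the open one. *)
  exists (Num.max 0 (x - r / 2)), (Num.min 1 (x + r / 2)); split.
  - rewrite gt_max !lt_min; lra.
  - move=> y; rewrite /= in_itv/= ge_max le_min => yab; split.
      by rewrite /unitC/= in_itv/=; lra.
    by apply: rJ; rewrite /= in_itv/=; lra.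
  - rewrite ge_max le_min; lra.
have [q qab] := rat_in_itvoo ab.
exists q => //; congr f; apply: same_connected_component; apply: connected_component_sym.
apply: (@connected_component_max _ _ `[a, b]%classic) => //.
- exact: segment_connected.
- by move: qab; rewrite /= !in_itv/= => /andP[/ltW -> /ltW ->].
Qed.

(** * Good points of an interval translation map *)

Section itm_structure.
Context {R : realType} (n : nat) (t c : nat -> R) (S : R -> R).
Hypothesis itm : is_ITM n t c S.

Lemma itm_t_le k l : (k <= l <= n)%N -> t k <= t l.
Proof.
case: itm => _ _ tlt _ /andP[kl]; elim: l kl => [|l IH].
  by rewrite leqn0 => /eqP ->.
rewrite leq_eqVlt => /predU1P[-> //|kl] ln.
by apply: le_trans (ltW (tlt l ln)); apply: IH => //; exact: ltnW.
Qed.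

Lemma itm_t_unitC k : (k <= n)%N -> 0 <= t k <= 1.
Proof.
case: itm => t0 tn _ _ kn; rewrite -t0 -tn.
by apply/andP; split; apply: itm_t_le; rewrite ?kn ?leqnn.
Qed.

(** Stated for any [f] because it locates both a point among the branches ([f = id]) and a value
    among their images under [h]. *)
Lemma itm_cut_gap (f : R -> R) x : f (t 0%N) <= x < f (t n) ->
  exists2 k, (k < n)%N & f (t k) <= x < f (t k.+1).
Proof.
move=> /andP[x0 xn].
have [k kn] : exists2 k, (k <= n)%N & x < f (t k) by exists n.
elim: k kn => [|k IH] kn xk; first by move: xk; rewrite ltNge x0.
have [|kx] := ltP x (f (t k)); first by move=> ?; exact: IH (ltnW kn) _.
by exists k => //; rewrite kx.
Qed.

Lemma itm_branchP x : unitI x <-> exists2 k, (k < n)%N & branch t k x.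
Proof.
split; rewrite /unitI/= in_itv/=.
  case: itm => t0 tn _ _ x01.
  by have [|k kn kx] := @itm_cut_gap id x; [rewrite t0 tn|exists k => //; rewrite /branch/= in_itv].
move=> [k kn]; rewrite /branch/= in_itv/= => /andP[kx xk].
have /andP[tk0 _] := itm_t_unitC (ltnW kn); have /andP[_ tk1] := itm_t_unitC kn.
by rewrite (le_trans tk0 kx) (lt_le_trans xk tk1).
Qed.

Lemma itm_branch_unitI k : (k < n)%N -> branch t k `<=` unitI.
Proof. by move=> kn x kx; apply/itm_branchP; exists k. Qed.

Lemma itm_branchE k x : (k < n)%N -> branch t k x -> S x = x + c k.
Proof. by case: itm => _ _ _ SE kn kx; have [] := SE k x kn kx. Qed.

Lemma itm_measurable : measurable_fun (unitI : set R) S.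
Proof.
move=> mI B mB.
have -> : unitI `&` S @^-1` B =
    \bigcup_(k < n) (branch t k `&` [set x | B (x + c k)]).
  apply/seteqP; split => [x [/itm_branchP[k kn kx] Sx]|x [k kn [kx Bx]]].
    by exists k => //; split=> //=; rewrite -(itm_branchE kn).
  by split; [exact: itm_branch_unitI kx|rewrite /= (itm_branchE kn)].
apply: bigcup_measurable => k _; apply: measurableI; first exact: measurable_itv.
rewrite -[X in measurable X]setTI.
have : measurable_fun setT (fun x : R => x + c k).
  by apply: nondecreasing_measurable => // x y; rewrite lerD2r.
exact.
Qed.

End itm_structure.

Section good_points.
Context {R : realType} (n : nat) (t c : nat -> R) (S : R -> R).
Context (mu : probability (measurableTypeR R) R) (X0 : set R).
Hypotheses (itm : is_ITM n t c S) (inv : invariant_probability S mu).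
Hypotheses (mu_atom : nonatomic mu) (dom : bijectivity_domain mu S X0).
Local Notation h := (distr mu).
Local Notation mu1 := (proj1 inv).
Local Notation X := (good_set mu n t S X0).

Lemma mu_setC_msupp : mu (~` msupp mu) = 0%E.
Proof.
apply: open_off_msupp.
- exact: measure0.
- move=> A B oA oB AB B0; rewrite -B0; apply: le_measure => //; rewrite inE;
    exact: open_measurable.
- by [].
- by move=> F oF F0; apply: null_bigcup => // i; apply: open_measurable.
- exact/closed_openC/closed_msupp.
- by rewrite setICl.
Qed.

Lemma countable_exceptional_set : countable (exceptional_set mu n t).
Proof.
pose A (f : set R -> R) := [set e | exists x, (unitC `\` msupp mu) x /\
  e = f (connected_component (unitC `\` msupp mu) x)].
apply: (@sub_countable _ _ _ (\bigcup_(i in [set: 'I_3])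
    nth setT [:: [set t k | k in [set k | (k <= n)%N]]; A inf; A sup] i)).
  apply: subset_card_le => e [et|[x [Dx [eE|eE]]]].
  - by exists ord0.
  - by exists (inord 1) => //; rewrite inordK//; exists x.
  - by exists (inord 2) => //; rewrite inordK//; exists x.
apply: bigcup_countable => [|i _]; first exact: countableP.
have cJ := @closed_msupp R mu.
case: i => -[|[|[|//]]] /= _.
- by apply: sub_countable (card_image_le _ _) _; exact: countableP.
- exact: countable_components.
- exact: countable_components.
Qed.

Let bad := \bigcup_(m : int) (iterz S X0 m @` (exceptional_set mu n t `&` X0)).

Let countable_bad : countable bad.
Proof.
apply: bigcup_countable => [|m _]; first exact: countableP.
apply: sub_countable (card_image_le _ _) _.
exact: sub_countable (subset_card_le (@subIsetl _ _ _)) countable_exceptional_set.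
Qed.

Lemma measurable_good : measurable (X : set (measurableTypeR R)).
Proof.
apply: measurableD; first by case: dom => -[].
by apply: countable_measurable countable_bad => x; exact: measurable_set1.
Qed.

Lemma mu_setC_good : mu (~` X) = 0%E.
Proof.
have [[mX0 _] muX0 _ _ _] := dom.
have mbad : measurable (bad : set (measurableTypeR R)).
  by apply: countable_measurable countable_bad => x; exact: measurable_set1.
rewrite /good_set -/bad setDE setCI setCK.
apply/eqP; rewrite eq_le measure_ge0 andbT.
apply: (le_trans (measureU2 _ _ _)) => //; first exact: measurableC.
have X0C : mu (~` (X0 : set (measurableTypeR R))) = 0%E.
  by rewrite probability_setC// muX0 subee.
have bad0 : mu bad = 0%E := null_countable mu_atom countable_bad.
by rewrite [X in (X + _)%E]X0C [X in (_ + X)%E]bad0 adde0.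
Qed.

Lemma good_sub x : X x -> [/\ X0 x, msupp mu x & unitI x].
Proof. by case: dom => -[_ X0J] _ _ _ _ [X0x _]; have [] := X0J _ X0x. Qed.

Lemma good_not_exceptional x : X x -> ~ exceptional_set mu n t x.
Proof. by move=> [X0x nb] ex; apply: nb; exists 0 => //; exists x. Qed.

(** The removed orbits are two-sided: if [S x] belongs to the [m]-th iterate of the exceptional set,
    then [x] belongs to the iterate of index [m - 1]. The cases are those of the encoding of
    integers, [Posz 0] being followed downwards by [Negz 0]. *)
Lemma good_stable x : X x -> X (S x).
Proof.
have [_ _ [Sfun Sinj Ssurj] _ _] := dom.
have pinvS y : X0 y -> pinv X0 S (S y) = y.
  by move=> X0y; apply: pinvKV => //; rewrite inE.
have pinvX0 y : X0 y -> X0 (pinv X0 S y).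
  by move=> /Ssurj[z X0z <-]; rewrite pinvS.
move=> [X0x nb]; split; first exact: Sfun.
move=> [[k|k] _ [e [ex X0e] /= eE]]; apply: nb.
  case: k eE => [/= eE|k /= eE].
    by exists (Negz 0) => //; exists e => //=; rewrite eE pinvS.
  exists (Posz k) => //; exists e => //=; apply: Sinj => //; rewrite inE //.
  by elim: k {eE} => //= k IH; exact: Sfun.
by exists (Negz k.+1) => //; exists e => //=; rewrite eE pinvS.
Qed.

Lemma good_gt0 x : X x -> 0 < x.
Proof.
move=> Xx; have [_ _] := good_sub Xx; rewrite /unitI/= in_itv/= => /andP[x0 _].
rewrite lt_neqAle x0 andbT; apply/negP => /eqP x0E; apply: (good_not_exceptional Xx).
by left; exists 0%N => //; case: itm => ->.
Qed.

Lemma itvoo_null_off_msupp (a b y : R) : mu `]a, b[%classic = 0%E ->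
  a < y < b -> ~ msupp mu y.
Proof.
move=> ab0 ayb /(_ `]a, b[%classic (@open_itvoo R a b)).
by rewrite ab0 ltxx /= in_itv/= => /(_ ayb).
Qed.

(* Otherwise [x] would be the right end of a component of the complement of the
   support, and such points have been removed from the good set. *)
Lemma good_distr_lt (x z : R) : X x -> 0 <= z < x -> h z < h x.
Proof.
move=> Xx /andP[z0 zx]; rewrite lt_neqAle (distr_nd mu1 (ltW zx)) andbT.
apply/negP => /eqP hzx; apply: (good_not_exceptional Xx).
have zx0 : mu `]z, x[%classic = 0%E by rewrite (mu_itvoo mu1 mu_atom (ltW zx)) hzx subrr.
have [_ Jx] := good_sub Xx; rewrite /unitI/= in_itv/= => x01.
right; pose D := unitC `\` msupp mu; pose w := (z + x) / 2.
have zxD : `]z, x[%classic `<=` D.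
  move=> y; rewrite /= in_itv/= => zyx; split.
    by rewrite /unitC/= in_itv/=; lra.
  exact: itvoo_null_off_msupp zx0 zyx.
have zxw : `]z, x[%classic w by rewrite /= in_itv/= /w; lra.
exists w; split; [exact: zxD|right].
set C := connected_component _ _.
have zxC : `]z, x[%classic `<=` C.
  apply: connected_component_max => //.
  by apply/connected_intervalP/interval_is_interval.
have ubC : ubound C x.
  move=> y Cy; rewrite leNgt; apply/negP => xy.
  have /connected_intervalP iC : connected C by exact: component_connected.
  have : C x by apply: (iC w y); [exact: zxC|exact: Cy|rewrite /w; lra].
  by move=> /connected_component_sub[].
apply/eqP; rewrite eq_le; apply/andP; split; last first.
  by apply: ge_sup => //; exists w; exact: zxC.
rewrite -[leLHS](@sup_itv R (BRight z) true x) ?bnd_simp//.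
apply: le_sup.
- by apply: (subset_trans zxC) => y Cy; exists y.
- by exists w.
- by split; [exists w; exact: zxC|exists x].
Qed.

Lemma good_distr_inj x y : X x -> X y -> h x = h y -> x = y.
Proof.
move=> Xx Xy hxy; have [xy|yx|//] := ltgtP x y.
  by have := @good_distr_lt y x Xy; rewrite (ltW (good_gt0 Xx)) xy hxy ltxx => /(_ isT).
by have := @good_distr_lt x y Xx; rewrite (ltW (good_gt0 Xy)) yx hxy ltxx => /(_ isT).
Qed.

Lemma distr_image_good : h @` X = `]0, 1] `&` quantile mu @^-1` X.
Proof.
apply: (distr_image mu1 mu_atom); first exact: good_distr_lt.
move=> x Xx; have [_ _] := good_sub Xx.
by rewrite /unitI/= !in_itv/= good_gt0// => /andP[_ /ltW].
Qed.

Lemma measurable_distr_image : measurable (h @` X : set (measurableTypeR R)).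
Proof.
rewrite distr_image_good; apply: measurableI; first exact: measurable_itv.
rewrite -[X in measurable X]setTI.
by apply: quantile_measurable; [exact: mu1| |exact: measurable_good].
Qed.

(** Apart from the point 0, the missing values are those that [quantile] sends outside the good set,
    and their Lebesgue measure is the [mu]-mass of its complement, which is 0. *)
Lemma lebesgue_setC_distr_image :
  lebesgue_measure (unitC `\` h @` X) = 0%E.
Proof.
have mX := measurable_good.
rewrite (_ : _ `\` _ = (quantile mu @^-1` (~` X) `&` `]0, 1]) `|` [set 0]); last first.
  rewrite distr_image_good; apply/seteqP; split => x.
    rewrite /unitC /= !in_itv/= => -[/andP[]]; rewrite le_eqVlt => /predU1P[<-|x0 x1].
      by right.
    by move=> nX; left; split; [move=> Xx; apply: nX; rewrite x0 x1|rewrite x0 x1].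
  rewrite /unitC /= !in_itv/= => -[[nX /andP[x0 x1]]|->].
    by rewrite ltW// x1; split => // -[].
  by rewrite lexx ler01 ltxx; split => // -[].
apply/eqP; rewrite eq_le measure_ge0 andbT.
have m1 : measurable (quantile mu @^-1` (~` X) `&` `]0, 1] : set (measurableTypeR R)).
  apply: measurableI; last exact: measurable_itv.
  rewrite -[X in measurable X]setTI.
  by apply: quantile_measurable; [exact: mu1| |exact: measurableC].
have m2 : measurable ([set 0] : set (measurableTypeR R)) by exact: measurable_set1.
apply: (le_trans (measureU2 _ m1 m2)).
have q0 : lebesgue_measure (quantile mu @^-1` (~` X) `&` `]0, 1]) = 0%E.
  by rewrite -(mu_quantile mu1 mu_atom) ?mu_setC_good//; exact: measurableC.
by rewrite [X in (X + _)%E]q0 add0e [leLHS]lebesgue_measure_set1.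
Qed.

End good_points.

Lemma ae_itv_exists {R : realType} (P : R -> Prop) (a b : R) : a < b ->
  {ae lebesgue_measure, forall x : R, P x} -> exists2 x, a < x < b & P x.
Proof.
move=> ab [N [mN N0 PN]]; apply: contrapT => nP.
have : (lebesgue_measure (`]a, b[%classic : set R) <= lebesgue_measure N)%E.
  apply: le_measure; rewrite ?inE// => x /=; rewrite in_itv/= => xab; apply: PN => Px; apply: nP.
  by exists x.
by rewrite N0 lebesgue_measure_itv/= lte_fin ab leNgt -EFinB lte_fin subr_gt0 ab.
Qed.

Lemma ae_translate {R : realType} (P : R -> Prop) (d : R) :
  {ae lebesgue_measure, forall x : R, P x} ->
  {ae lebesgue_measure, forall x : R, P (x + d)}.
Proof.
move=> [N [mN N0 PN]]; exists [set x | N (x + d)]; split.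
- rewrite -[X in measurable X]setTI.
  have : measurable_fun setT (fun x : R => x + d).
    by apply: nondecreasing_measurable => // x y; rewrite lerD2r.
  exact.
- by rewrite lebesgue_measure_translate.
- by move=> x nPx; exact: PN.
Qed.

Lemma ae_and {R : realType} (P Q : R -> Prop) :
  {ae lebesgue_measure, forall x : R, P x} -> {ae lebesgue_measure, forall x : R, Q x} ->
  {ae lebesgue_measure, forall x : R, P x /\ Q x}.
Proof. exact: (@filterI _ _ (ae_filter_ringOfSetsType (@lebesgue_measure R))). Qed.

Lemma midf_ex {R : realFieldType} (a b : R) : a < b -> exists v, a < v < b.
Proof. by move=> ab; exists ((a + b) / 2); lra. Qed.

(** * Defect measures *)

Section defect.
Context {R : realType} (n : nat) (t c : nat -> R) (S : R -> R).
Context (mu : probability (measurableTypeR R) R).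
Hypotheses (itm : is_ITM n t c S) (inv : invariant_probability S mu).
Hypotheses (mu_atom : nonatomic mu).
Local Notation h := (distr mu).
Local Notation mu1 := (proj1 inv).
Local Notation rho := (defect_pushforward mu t c).

Lemma image_translate (d : R) (B : set R) :
  [set x + d | x in B] = [set y | B (y - d)].
Proof.
apply/seteqP; split => [_ [x Bx <-]|y By] /=; first by rewrite addrK.
by exists (y - d) => //; rewrite subrK.
Qed.

Lemma measurable_image_translate (d : R) (B : set R) :
  measurable B -> measurable [set x + d | x in B].
Proof.
move=> mB; rewrite image_translate -[X in measurable X]setTI.
have : measurable_fun setT (fun x : R => x - d).
  by apply: nondecreasing_measurable => // x y; rewrite lerD2r.
exact.
Qed.

Lemma measurable_defect_fiber k (B : set R) : measurable B ->
  measurable ((unitI `\` branch t k) `&` [set x | B (S x - c k)]).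
Proof.
move=> mB; rewrite (_ : [set x | _] = S @^-1` [set x + c k | x in B]); last first.
  by rewrite image_translate.
rewrite setDE setIAC -setDE; apply: measurableD; last exact: measurable_itv.
by apply: (itm_measurable itm); [exact: measurable_itv|exact: measurable_image_translate].
Qed.

(** By invariance the translate of [B] has the mass of its preimage under [S]. The part of the
    preimage inside the branch is [B] itself, so the defect is the mass arriving from outside the
    branch, visibly nonnegative and monotone. *)
Lemma defect_measureE k (B : set R) : (k < n)%N -> measurable B ->
  B `<=` branch t k ->
  defect_measure mu (c k) B =
    mu ((unitI `\` branch t k) `&` [set x | B (S x - c k)]).
Proof.
move=> kn mB Bk; have m2 := @measurable_defect_fiber k B mB.
rewrite /defect_measure -inv.2; last exact: measurable_image_translate.
rewrite image_translate (_ : _ `&` _ =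
  B `|` ((unitI `\` branch t k) `&` [set x | B (S x - c k)])); last first.
  apply/seteqP; split => x.
    move=> [Ix /= Bx]; have [kx|nkx] := pselect (branch t k x); last by right.
    by left; rewrite -[x](addrK (c k)) -(itm_branchE itm kn).
  case=> [Bx|[[Ix _] Bx]//]; have kx := Bk _ Bx; split.
    exact: itm_branch_unitI itm _ kn _ kx.
  by rewrite /= (itm_branchE itm kn)// addrK.
rewrite measureU//; last first.
  by apply/seteqP; split => // x [Bx [[_ /(_ (Bk _ Bx))]]].
by rewrite addeAC subee ?add0e//; exact: fin_num_measure.
Qed.

Lemma le_defect_measure k (A B : set R) : (k < n)%N -> measurable A -> measurable B ->
  A `<=` B -> B `<=` branch t k ->
  (defect_measure mu (c k) A <= defect_measure mu (c k) B)%E.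
Proof.
move=> kn mA mB AB Bk.
rewrite !defect_measureE//; last exact: subset_trans Bk.
by apply: le_measure; rewrite ?inE;
  [exact: measurable_defect_fiber|exact: measurable_defect_fiber|move=> x [? /AB]].
Qed.

Lemma defect_measure_ge0 k (B : set R) : (k < n)%N -> measurable B ->
  B `<=` branch t k -> (0 <= defect_measure mu (c k) B)%E.
Proof. by move=> kn mB Bk; rewrite defect_measureE. Qed.

Lemma defect_measure_itvoo (d p q : R) : p <= q ->
  defect_measure mu d `]p, q[%classic = ((h (q + d) - h (p + d)) - (h q - h p))%:E.
Proof.
move=> pq; rewrite /defect_measure image_translate.
rewrite (_ : [set y | _] = `]p + d, q + d[%classic); last first.
  by apply/seteqP; split => y /=; rewrite !in_itv/= ltrBrDr ltrBlDr.
by rewrite !(mu_itvoo mu1 mu_atom) ?lerD2r// -EFinB.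
Qed.

(** [rho k] is the image under [defect_point k] of [mu] restricted to [defect_dom k], the points
    outside the branch that [S] sends into the translated branch. This form yields countable
    additivity. *)
Let defect_point k (x : R) := h (S x - c k).

Let defect_dom k := unitI `&` S @^-1` [set x + c k | x in branch t k] `\` branch t k.

Let measurable_distr_preimage (E : set R) : measurable E -> measurable (h @^-1` E : set R).
Proof.
move=> mE; rewrite -[X in measurable X]setTI.
by have := distr_measurable mu1; exact.
Qed.

Let defect_pushforwardE k (E : set R) : (k < n)%N -> measurable E ->
  measurable (defect_dom k `&` defect_point k @^-1` E : set R) /\
  rho k E = mu (defect_dom k `&` defect_point k @^-1` E).
Proof.
move=> kn mE.
have mk : measurable (branch t k : set R) by exact: measurable_itv.
have mB : measurable (h @^-1` E `&` branch t k : set R).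
  by apply: measurableI => //; exact: measurable_distr_preimage.
have -> : defect_dom k `&` defect_point k @^-1` E =
    (unitI `\` branch t k) `&` [set x | (h @^-1` E `&` branch t k) (S x - c k)].
  rewrite /defect_dom image_translate; apply/seteqP.
  by split => x; [move=> [[[? ?] ?] ?]|move=> [[? ?] [? ?]]].
split; last by rewrite -defect_measureE//; exact: subIsetr.
exact: measurable_defect_fiber.
Qed.

Lemma defect_pushforward_off_msupp k (U : set R) : (k < n)%N ->
  open U -> U `&` msupp (rho k) = set0 -> rho k U = 0%E.
Proof.
move=> kn; apply: open_off_msupp.
- by have [_ ->] := @defect_pushforwardE k set0 kn measurable0; rewrite preimage_set0 setI0.
- move=> A B /open_measurable mA /open_measurable mB AB <-.
  have [m1 ->] := defect_pushforwardE kn mA; have [m2 ->] := defect_pushforwardE kn mB.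
  by apply: le_measure; rewrite ?inE// => x [? /AB].
- by move=> A /open_measurable mA; have [m1 ->] := defect_pushforwardE kn mA.
- move=> F oF F0; have mF i : measurable (F i) := open_measurable (oF i).
  have [_ ->] := defect_pushforwardE kn (bigcupT_measurable _ mF).
  rewrite preimage_bigcup setI_bigcupr; apply: null_bigcup => i.
    by have [] := defect_pushforwardE kn (mF i).
  by have [_ E] := defect_pushforwardE kn (mF i); have := F0 i; rewrite E.
Qed.

(** On []p, q[] the function [h], which may have plateaus, is only known to take values in the
    closed interval from [h p] to [h q]; the strict margins let an open interval contain it. *)
Lemma defect_itvoo_le_pushforward k (p q a b : R) : (k < n)%N ->
  t k <= p -> p <= q -> q <= t k.+1 -> a < h p -> h q < b ->
  (((h (q + c k) - h (p + c k)) - (h q - h p))%:E <= rho k `]a, b[%classic)%E.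
Proof.
move=> kn kp pq qk ap qb; rewrite -defect_measure_itvoo//; apply: le_defect_measure => //.
- apply: measurableI; last exact: measurable_itv.
  by apply: measurable_distr_preimage; exact: measurable_itv.
- move=> x; rewrite /= in_itv/= => /andP[/ltW px xq]; split; last first.
    by rewrite /branch/= in_itv/= (le_trans kp px) (lt_le_trans xq qk).
  rewrite /= in_itv/= (lt_le_trans ap (distr_nd mu1 px)).
  by rewrite (le_lt_trans (distr_nd mu1 (ltW xq)) qb).
Qed.

(** The converse estimate has no margins: by monotonicity, values strictly between [h p] and [h q]
    are taken only inside []p, q[]. *)
Lemma defect_pushforward_le_itvoo k (p q : R) : (k < n)%N ->
  t k <= p -> p <= q -> q <= t k.+1 ->
  (rho k `]h p, h q[%classic <= ((h (q + c k) - h (p + c k)) - (h q - h p))%:E)%E.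
Proof.
move=> kn kp pq qk; rewrite -defect_measure_itvoo//; apply: le_defect_measure => //.
- apply: measurableI; last exact: measurable_itv.
  by apply: measurable_distr_preimage; exact: measurable_itv.
- move=> x [+ _]; rewrite /= !in_itv/= => /andP[px xq].
  apply/andP; split; rewrite ltNge; apply/negP => /(distr_nd mu1).
    by rewrite leNgt px.
  by rewrite leNgt xq.
- move=> x; rewrite /branch/= !in_itv/= => /andP[/ltW px xq].
  by rewrite (le_trans kp px) (lt_le_trans xq qk).
Qed.

Lemma distr_t0 : h (t 0%N) = 0.
Proof. by case: itm => -> _ _ _; rewrite (distr_le0 mu1 mu_atom). Qed.

Lemma distr_tn : h (t n) = 1.
Proof. by case: itm => _ -> _ _; rewrite (distr_ge1 mu1). Qed.

Lemma closed_defect_cut_set : closed (defect_cut_set mu n t c).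
Proof.
apply: closedU.
  apply: (accessible_finite_set_closed.1 (hausdorff_accessible (@Rhausdorff R))).
  by apply: finite_image; exact: (finite_II n.+1).
apply: closed_bigcup => [|k _]; first exact: (finite_II n).
exact: closed_msupp.
Qed.

End defect.

(** * The canonical model *)

Section model.
Context {R : realType} (n : nat) (t c : nat -> R) (S : R -> R).
Context (mu : probability (measurableTypeR R) R) (X0 : set R) (ustar : R).
Hypotheses (itm : is_ITM n t c S) (inv : invariant_probability S mu).
Hypotheses (mu_atom : nonatomic mu) (dom : bijectivity_domain mu S X0).
Hypothesis ustar01 : unitC ustar.
Local Notation h := (distr mu).
Local Notation mu1 := (proj1 inv).
Local Notation rho := (defect_pushforward mu t c).
Local Notation X := (good_set mu n t S X0).
Local Notation T := (canonical_model mu n t S X0 ustar).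
Local Notation Cdef := (defect_cut_set mu n t c).

Let pinv_distr x : X x -> pinv X h (h x) = x.
Proof.
move=> Xx; apply: pinvKV; last by rewrite inE.
by move=> y z /[!inE] Xy Xz; apply: (good_distr_inj itm inv mu_atom dom).
Qed.

Lemma model_distr x : X x -> T (h x) = h (S x).
Proof.
move=> Xx; rewrite /canonical_model ifT ?pinv_distr//.
by rewrite inE; exists x.
Qed.

Lemma model_unitC u : unitC (T u).
Proof. by rewrite /canonical_model; case: ifP => _ //; exact: distr_unitC mu1 _. Qed.

Lemma model_inj u v : (h @` X) u -> (h @` X) v -> T u = T v -> u = v.
Proof.
move=> [x Xx <-] [y Xy <-]; rewrite !model_distr//.
move=> /(good_distr_inj itm inv mu_atom dom (good_stable dom Xx) (good_stable dom Xy)) Sxy.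
have [_ _ [_ Sinj _] _ _] := dom; congr h.
by apply: Sinj => //; rewrite inE; [have [] := good_sub dom Xx|have [] := good_sub dom Xy].
Qed.

(** On the image of the good set [T] agrees with [h \o S \o quantile], a composition of measurable
    maps, and it is constant elsewhere; the chosen inverse in its definition disappears. *)
Lemma model_measurable : measurable_fun unitC T.
Proof.
have mY := measurable_distr_image itm inv mu_atom dom.
have YE := distr_image_good itm inv mu_atom dom.
have mX := measurable_good n t dom.
have mT : measurable_fun (h @` X) (h \o (S \o quantile mu)).
  have mq : measurable_fun (h @` X) (quantile mu).
    by apply: measurable_funTS; exact: quantile_measurable mu1.
  have mS : measurable_fun X S.
    have [[mX0 _] _ _ [mS _] _] := dom.
    by apply: measurable_funS mS => // x [].
  apply: measurableT_comp; first exact: distr_measurable mu1.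
  apply: (measurable_comp mX) mq => //.
  by rewrite YE => _ [u [_ Xu] <-].
move=> mC B mB.
have -> : unitC `&` T @^-1` B = (h @` X `&` (h \o (S \o quantile mu)) @^-1` B) `|`
    ((unitC `\` h @` X) `&` (cst ustar) @^-1` B).
  have Yunit : h @` X `<=` unitC by move=> _ [x _ <-]; exact: distr_unitC mu1 _.
  have TY u : (h @` X) u -> T u = h (S (quantile mu u)).
    move=> Yu; have := Yu; rewrite {1}YE => -[u01 Xq].
    by rewrite -(model_distr Xq) (distr_quantile mu1 mu_atom).
  have TnY u : ~ (h @` X) u -> T u = ustar.
    by move=> Yu; rewrite /canonical_model ifF//; apply/negP; rewrite inE.
  apply/seteqP; split => u.
    move=> [Cu /= Bu]; have [Yu|nYu] := pselect ((h @` X) u).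
      by left; split => //=; rewrite -TY.
    by right; split => //=; rewrite -(TnY _ nYu).
  case=> [[Yu /= Bu]|[[Cu nYu] /= Bu]].
    by split; [exact: Yunit|rewrite /= TY].
  by split => //=; rewrite TnY.
apply: measurableU; first exact: mT.
apply: measurable_cst => //.
by apply: measurableD => //; exact: measurable_itv.
Qed.

Lemma ae_distr_image : {ae lebesgue_measure, forall u : R, unitC u -> (h @` X) u}.
Proof.
exists (unitC `\` h @` X); split.
- apply: measurableD; first exact: measurable_itv.
  exact: measurable_distr_image itm inv mu_atom dom.
- exact: lebesgue_setC_distr_image itm inv mu_atom dom.
- by move=> u /not_implyP.
Qed.

Lemma dense_distr_image (P : R -> Prop) (a b : R) : a < b ->
  `]a, b[%classic `<=` unitC -> {ae lebesgue_measure, forall u : R, P u} ->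
  exists u, [/\ a < u < b, (h @` X) u & P u].
Proof.
move=> ab abC aeP.
have [|u uab [Yu Pu]] := @ae_itv_exists _ (fun u => (unitC u -> (h @` X) u) /\ P u) a b ab.
  exact: ae_and ae_distr_image aeP.
by exists u; split => //; apply: Yu; apply: abC; rewrite /= in_itv.
Qed.

Lemma good_branch k x : (k < n)%N -> X x -> h (t k) < h x < h (t k.+1) -> branch t k x.
Proof.
move=> kn Xx /andP[kx xk]; rewrite /branch/= in_itv/= ltW/=; last first.
  by rewrite ltNge; apply/negP => /(distr_nd mu1); rewrite leNgt kx.
by rewrite ltNge; apply/negP => /(distr_nd mu1); rewrite leNgt xk.
Qed.

(* On a branch [T u - u = h (x + c k) - h x], whose increments are defect
   masses. *)
Lemma model_translation (a b : R) : a < b -> `]a, b[%classic `<=` unitC ->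
  `]a, b[ `&` Cdef = set0 ->
  exists d, forall u, (h @` X) u -> a < u < b -> T u = u + d.
Proof.
move=> ab abC ab0.
have [a0 b1] : 0 <= a /\ b <= 1.
  split; rewrite leNgt; apply/negP => ?.
    have [v /andP[av]] : exists v, a < v < Num.min b 0.
      by apply: midf_ex; rewrite lt_min ab.
    rewrite lt_min => /andP[vb v0]; have /abC : `]a, b[%classic v by rewrite /= in_itv/= av.
    by rewrite /unitC/= in_itv/= leNgt v0.
  have [v /andP[]] : exists v, Num.max a 1 < v < b by apply: midf_ex; rewrite gt_max ab.
  rewrite gt_max => /andP[av v1] vb; have /abC : `]a, b[%classic v by rewrite /= in_itv/= av.
  by rewrite /unitC/= in_itv/= [v <= 1]leNgt v1 andbF.
have [k kn /andP[ka ak]] : exists2 k, (k < n)%N & h (t k) <= a < h (t k.+1).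
  apply: itm_cut_gap.
  by rewrite (distr_t0 itm inv mu_atom) (distr_tn itm inv) a0/= (lt_le_trans ab).
have bk : b <= h (t k.+1).
  rewrite leNgt; apply/negP => bk.
  have : (`]a, b[ `&` Cdef) (h (t k.+1)).
    split; first by rewrite /= in_itv/= ak.
    by left; exists k.+1.
  by rewrite ab0.
have rho0 : rho k `]a, b[%classic = 0%E.
  apply: (defect_pushforward_off_msupp itm inv) => //.
  apply/seteqP; split => // x [abx rx].
  by rewrite -ab0; split => //; right; exists k.
(* The translation constant is read off at one good value [u0]; without any, the claim is
   vacuous. *)
have [[u0 [[x0 Xx0 hx0] u0ab]]|nou] :=
    pselect (exists u, (h @` X) u /\ a < u < b); last first.
  by exists 0 => u Yu uab; exfalso; apply: nou; exists u.
have kbr x : X x -> a < h x < b -> branch t k x.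
  move=> Xx /andP[ax xb]; apply: good_branch => //.
  by rewrite (le_lt_trans ka ax) (lt_le_trans xb bk).
have incr x y : X x -> X y -> a < h x < b -> a < h y < b -> x <= y ->
    h (S x) - h x = h (S y) - h y.
  move=> Xx Xy xab yab xy; have kx := kbr _ Xx xab; have ky := kbr _ Xy yab.
  rewrite !(itm_branchE itm kn)//.
  have := kx; have := ky; rewrite /branch/= !in_itv/= => /andP[_ yk] /andP[kx' _].
  have /andP[ax _] := xab; have /andP[_ yb] := yab.
  (* Here []a, b[] supplies the strict margins, so the increment is at most [rho k] of it, which is
     0; positivity of the defect gives the other inequality. *)
  have := defect_itvoo_le_pushforward itm inv mu_atom kn kx' xy (ltW yk) ax yb.
  rewrite rho0 lee_fin => le1.
  have pq : (0 <= defect_measure mu (c k) `]x, y[%classic)%E.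
    apply: (defect_measure_ge0 itm inv) => // z; rewrite /branch/= !in_itv/=.
    by move=> /andP[/ltW xz zy]; rewrite (le_trans kx' xz) (lt_trans zy yk).
  move: pq; rewrite (defect_measure_itvoo inv)// lee_fin => ge1.
  lra.
exists (h (S x0) - h x0) => _ [x Xx <-] xab; rewrite model_distr//.
have -> : h (S x0) - h x0 = h (S x) - h x.
  have x0ab : a < h x0 < b by rewrite hx0.
  by have [x0x|/ltW xx0] := leP x0 x; [exact: incr|apply/esym; exact: incr].
by rewrite addrC subrK.
Qed.

(** Otherwise a nonempty open piece of []a, b[] would be translated out of [[0, 1]]; it contains a
    good value, at which [T] still takes a value in [[0, 1]]. *)
Lemma model_translation_bounds (a b d : R) : a < b -> `]a, b[%classic `<=` unitC ->
  (forall u, (h @` X) u -> a < u < b -> T u = u + d) -> 0 <= a + d /\ b + d <= 1.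
Proof.
move=> ab abC Td; split; rewrite leNgt; apply/negP => ?.
  have [|||u [uab Yu _]] := @dense_distr_image (fun=> True) a (Num.min b (- d)).
  - by rewrite lt_min ab/=; lra.
  - apply: subset_trans abC => u; rewrite /= !in_itv/= lt_min; lra.
  - exact: aeW.
  have := model_unitC u; rewrite Td//; last by move: uab; rewrite lt_min; lra.
  by rewrite /unitC/= in_itv/=; move: uab; rewrite lt_min; lra.
have [|||u [uab Yu _]] := @dense_distr_image (fun=> True) (Num.max a (1 - d)) b.
- by rewrite gt_max ab/=; lra.
- apply: subset_trans abC => u; rewrite /= !in_itv/= gt_max; lra.
- exact: aeW.
have := model_unitC u; rewrite Td//; last by move: uab; rewrite gt_max; lra.
by rewrite /unitC/= in_itv/=; move: uab; rewrite gt_max; lra.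
Qed.

(** If the translated intervals meet, they share an open interval. For almost every point of it,
    both its pullbacks [v] and [v + (d - d')] are good values with the same image under [T];
    injectivity makes them equal, so [v] lies in both original intervals. *)
Lemma model_translation_disjoint (a b d a' b' d' w : R) :
  `]a, b[%classic `<=` unitC -> `]a', b'[%classic `<=` unitC ->
  (forall u, (h @` X) u -> a < u < b -> T u = u + d) ->
  (forall u, (h @` X) u -> a' < u < b' -> T u = u + d') ->
  a + d < w < b + d -> a' + d' < w < b' + d' ->
  exists v, a < v < b /\ a' < v < b'.
Proof.
move=> abC ab'C Td Td' wab wab'.
pose p := Num.max (a + d) (a' + d'); pose q := Num.min (b + d) (b' + d').
have pq : p < q by rewrite /p /q gt_max !lt_min; lra.
have [||v [vpq Yv Yv']] := @dense_distr_image
    (fun v => unitC (v + (d - d')) -> (h @` X) (v + (d - d'))) (p - d) (q - d) _ _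
    (ae_translate (d - d') ae_distr_image).
- lra.
- apply: subset_trans abC => v; rewrite /= !in_itv/= => vpq.
  by move: vpq; rewrite !ltrBlDr !ltrBrDr /p /q gt_max lt_min; lra.
have [vab vab'] : a < v < b /\ a' < v + (d - d') < b'.
  by move: vpq; rewrite !ltrBlDr !ltrBrDr /p /q gt_max lt_min; lra.
have Yv2 : (h @` X) (v + (d - d')) by apply: Yv'; apply: ab'C; rewrite /= in_itv.
have /(model_inj Yv Yv2) E : T v = T (v + (d - d')) by rewrite Td// Td'//; lra.
by exists v; split => //; rewrite -E in vab'.
Qed.

(** A translation near [e] would give [T u - u] the same value at two good values [h x < e < h y] of
    the branch. The defect between [x] and [y] would vanish, and with it [rho k] on a neighbourhood
    of [e]. *)
Lemma essential_of_msupp k (e : R) : (k < n)%N -> h (t k) < e < h (t k.+1) ->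
  msupp (rho k) e -> essential_cut T e.
Proof.
move=> kn ke rhoe; have /andP[? ?] := ke.
have /andP[tk0 tk1] := itm_t_unitC itm (ltnW kn).
have := distr_ge0 mu1 (t k); have := distr_le1 mu1 (t k.+1) => h1 h0.
split; first lra.
move=> [V [d [/nbhs_itvoo[r r0 rV] TV]]].
have unit_sub a b : h (t k) <= a -> b <= h (t k.+1) -> `]a, b[%classic `<=` unitC.
  by move=> *; move=> u; rewrite /unitC/= !in_itv/=; lra.
have [||u1 [u1e [x Xx xE] Tu1]] := dense_distr_image
    (a := Num.max (e - r) (h (t k))) (b := e) _ _ TV.
- by rewrite gt_max; lra.
- by apply: unit_sub; rewrite ?le_max ?lexx ?orbT//; lra.
have [||u2 [u2e [y Xy yE] Tu2]] := dense_distr_image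
    (a := e) (b := Num.min (e + r) (h (t k.+1))) _ _ TV.
- by rewrite lt_min; lra.
- by apply: unit_sub; rewrite ?ge_min ?lexx ?orbT//; lra.
subst u1 u2.
have {}Tu1 : T (h x) = h x + d.
  by apply/Tu1/rV; rewrite /= in_itv/=; move: u1e; rewrite gt_max; lra.
have {}Tu2 : T (h y) = h y + d.
  by apply/Tu2/rV; rewrite /= in_itv/=; move: u2e; rewrite lt_min; lra.
have kx : branch t k x by apply: good_branch => //; move: u1e; rewrite gt_max; lra.
have ky : branch t k y by apply: good_branch => //; move: u2e; rewrite lt_min; lra.
have xy : x <= y.
  by rewrite leNgt; apply/negP => /ltW/(distr_nd mu1); lra.
have : (0 < rho k `]h x, h y[%classic)%E.
  by apply: rhoe; [exact: open_itvoo|rewrite /= in_itv/=; lra].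
have [kx0 yk0] : t k <= x /\ y <= t k.+1.
  by move: kx ky; rewrite /branch/= !in_itv/= => /andP[-> _] /andP[_ /ltW ->].
have := defect_pushforward_le_itvoo itm inv mu_atom kn kx0 xy yk0.
move: Tu1 Tu2; rewrite !model_distr// !(itm_branchE itm kn)// => -> ->.
rewrite (_ : _ - _ - _ = 0); last lra.
by move=> /le_lt_trans/[apply]; rewrite ltxx.
Qed.

End model.

(** * From a null or finite cut set to an interval exchange *)

Lemma open_is_interval_itvoo {R : realType} (U : set R) :
  open U -> is_interval U -> U `<=` unitC -> exists p : R * R, U = `]p.1, p.2[%classic.
Proof.
move=> oU iU UC; have [->|/set0P[x Ux]] := eqVneq U set0.
  by exists (0, 0) => /=; rewrite set_itvoo0.
exists (inf U, sup U); have := interval_bounded_interior iU.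
rewrite ((@interior_id _ U).1 oU) => UE; rewrite /= [LHS]UE.
- by apply/seteqP; split => y /=; rewrite in_itv.
- by exists 0 => y /UC; rewrite /unitC/= in_itv/= => /andP[].
- by exists 1 => y /UC; rewrite /unitC/= in_itv/= => /andP[].
Qed.

Lemma measure_bigcup_eq {R : realType} (U V : nat -> set R) :
  (forall m, measurable (U m)) -> (forall m, measurable (V m)) ->
  trivIset setT U -> trivIset setT V ->
  (forall m, lebesgue_measure (U m) = lebesgue_measure (V m)) ->
  lebesgue_measure (\bigcup_m U m) = lebesgue_measure (\bigcup_m V m).
Proof.
move=> mU mV tU tV UV; rewrite !measure_bigcup//;
  [|by move=> m _; exact: mV|by move=> m _; exact: mU].
by apply: eq_eseriesr => m _; exact: UV.
Qed.

Lemma lebesgue_measure_unitC_setD {R : realType} (A : set R) : measurable A ->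
  A `<=` unitC -> (lebesgue_measure (unitC `\` A) = 0 <-> lebesgue_measure A = 1)%E.
Proof.
move=> mA AC; have mC : measurable (unitC : set R) by exact: measurable_itv.
have C1 : lebesgue_measure (unitC : set R) = 1%E.
  by rewrite lebesgue_measure_itv/= lte_fin ltr01 oppr0 adde0.
have E : (lebesgue_measure (unitC `\` A) + lebesgue_measure A = 1)%E.
  rewrite -C1 -measureU//; [|exact: measurableD|by apply/seteqP; split => // x [[]]].
  by rewrite setDKU.
split => H; first by rewrite H add0e in E.
move: E; rewrite H; case: (lebesgue_measure _) => //= r [] /eqP.
by rewrite -subr_eq0 addrK => /eqP ->.
Qed.

Section exchange.
Context {R : realType} (n : nat) (t c : nat -> R) (S : R -> R).
Context (mu : probability (measurableTypeR R) R) (X0 : set R) (ustar : R).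
Hypotheses (itm : is_ITM n t c S) (inv : invariant_probability S mu).
Hypotheses (mu_atom : nonatomic mu) (dom : bijectivity_domain mu S X0).
Hypothesis ustar01 : unitC ustar.
Local Notation h := (distr mu).
Local Notation mu1 := (proj1 inv).
Local Notation X := (good_set mu n t S X0).
Local Notation T := (canonical_model mu n t S X0 ustar).
Local Notation Cdef := (defect_cut_set mu n t c).

Lemma defect_cut_set0 : Cdef 0.
Proof. by left; exists 0%N => //; rewrite (distr_t0 itm inv mu_atom). Qed.

Lemma defect_cut_set1 : Cdef 1.
Proof. by left; exists n => /=; rewrite ?(distr_tn itm inv). Qed.

Lemma image_translate_itvoo (a b d : R) :
  [set u + d | u in `]a, b[%classic] = `]a + d, b + d[%classic.
Proof.
rewrite image_translate.
by apply/seteqP; split => y /=; rewrite !in_itv/= ltrBrDr ltrBlDr.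
Qed.

(** The intervals are the components of []0, 1[] minus the closed cut set. That their translates
    cover [[0, 1]] is a matter of length: they are disjoint, lie in [[0, 1]], and have the same
    total length 1 as the components. *)
Lemma countable_IET_model : lebesgue_measure Cdef = 0%E -> countable_IET T.
Proof.
move=> Cdef0; split.
- exact: model_measurable ustar itm inv mu_atom dom.
- by move=> u _; exact: model_unitC inv ustar01 u.
have oO : open (`]0, 1[%classic `\` Cdef : set R).
  by rewrite setDE; apply: openI => //; apply: closed_openC; exact: closed_defect_cut_set.
set O := _ `\` _ in oO.
pose U := open_disjoint_itv oO.
have UO m : U m `<=` O.
  by move=> x Ux; rewrite (open_disjoint_itv_bigcup oO); exists m.
have OC : O `<=` unitC.
  by move=> x [+ _]; rewrite /unitC/= !in_itv/= => /andP[/ltW -> /ltW ->].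
have /choice[p pP] m : exists p : R * R * R, U m = `]p.1.1, p.1.2[%classic /\
    forall u, (h @` X) u -> p.1.1 < u < p.1.2 -> T u = u + p.2.
  have [] := @open_is_interval_itvoo _ (U m).
  - exact: open_disjoint_itv_open.
  - exact: open_disjoint_itv_is_interval.
  - by move=> x /UO/OC.
  (* The enumeration of components may contain empty members, which receive the constant 0. *)
  move=> [a b] /= UE; have [ab|ba] := ltP a b; last first.
    by exists (a, b, 0); split => // u _ /andP[au ub]; have := lt_trans au ub; rewrite ltNge ba.
  have [||d dP] := model_translation ustar itm inv mu_atom dom ab.
  - by rewrite -UE => x /UO/OC.
  - by apply/seteqP; split => // x []; rewrite -UE => /UO[].
  by exists (a, b, d).
pose a m := (p m).1.1; pose b m := (p m).1.2; pose d m := (p m).2.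
exists a, b, d => /=.
have UE m : `]a m, b m[%classic = U m by have [] := pP m.
have Td m u : (h @` X) u -> a m < u < b m -> T u = u + d m by have [_] := pP m; exact.
have tU : trivIset setT (fun m => `]a m, b m[%classic : set R).
  by move=> i j _ _; rewrite !UE => ij; apply: (@open_disjoint_itv_trivIset _ _ oO).
have abC m : `]a m, b m[%classic `<=` unitC by rewrite UE => x /UO/OC.
have U1 : lebesgue_measure (\bigcup_m `]a m, b m[%classic : set R) = 1%E.
  apply/lebesgue_measure_unitC_setD.
  - by apply: bigcupT_measurable => m; exact: measurable_itv.
  - by move=> x [m _ /abC].
  apply/eqP; rewrite eq_le measure_ge0 andbT -Cdef0; apply: le_measure; rewrite ?inE.
  - apply: measurableD; first exact: measurable_itv.
    by apply: bigcupT_measurable => m; exact: measurable_itv.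
  - by apply: closed_measurable; exact: closed_defect_cut_set.
  - move=> x []; rewrite /unitC/= in_itv/= => /andP[x0 x1] nUx; apply: contrapT => nCx.
    apply: nUx; have : O x.
      split => //; rewrite /= in_itv/= !lt_neqAle x0 x1 !andbT.
      apply/andP; split; apply/eqP => xE; apply: nCx.
        by rewrite -xE; exact: defect_cut_set0.
      by rewrite xE; exact: defect_cut_set1.
    by rewrite [in O x](open_disjoint_itv_bigcup oO) => -[m _ Umx]; exists m => //; rewrite UE.
have tV : trivIset setT (fun m => [set u + d m | u in `]a m, b m[%classic] : set R).
  move=> i j _ _ [w []]; rewrite !image_translate_itvoo /= !in_itv/= => wi wj.
  have [v [vi vj]] := model_translation_disjoint itm inv mu_atom dom
    (abC i) (abC j) (@Td i) (@Td j) wi wj.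
  by apply: tU => //; exists v; split; rewrite /= in_itv.
have VC m : [set u + d m | u in `]a m, b m[%classic] `<=` unitC.
  move=> _ [u uab <-]; move: uab; rewrite /unitC/= !in_itv/= => /andP[au ub].
  have [] := model_translation_bounds itm inv mu_atom dom ustar01 (lt_trans au ub) (abC m) (@Td m).
  lra.
split => //.
- apply/lebesgue_measure_unitC_setD => //.
  + by apply: bigcupT_measurable => m; exact: measurable_itv.
  + by move=> x [m _ /abC].
- move=> m; have := ae_distr_image itm inv mu_atom dom.
  move=> [N [mN N0 YN]]; exists N; split => // u nTu; apply: YN => Yu; apply: nTu => abu.
  by apply: Td; [exact/Yu/(abC m)|move: abu; rewrite /= in_itv].
- apply/lebesgue_measure_unitC_setD => //.
  + by apply: bigcupT_measurable => m; rewrite image_translate_itvoo; exact: measurable_itv.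
  + by move=> x [m _ /VC].
  rewrite -[RHS]U1; apply: measure_bigcup_eq => // m; rewrite image_translate_itvoo//.
  by rewrite !lebesgue_measure_itv/= !lte_fin ltrD2r; case: ifP => // _; congr EFin; lra.
Qed.

(** [h] takes no value outside [[0, 1]], so [rho k] vanishes there. This makes 0 and 1 the extreme
    entries of the sorted cut set. *)
Lemma defect_cut_set_unitC : Cdef `<=` unitC.
Proof.
have empty k (a b : R) : (forall y, ~ a < h y < b) ->
    defect_pushforward mu t c k `]a, b[%classic = 0%E.
  move=> hab; rewrite /defect_pushforward (_ : _ `&` _ = set0).
    by rewrite /defect_measure image_set0 measure0 subee.
  by apply/seteqP; split => // y [/=]; rewrite in_itv/= => /hab.
move=> x [[k _ <-]|[k _ xk]]; first exact: distr_unitC mu1 _.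
rewrite /unitC/= in_itv/=; apply/andP; split; rewrite leNgt; apply/negP => ?.
  have : (0 < defect_pushforward mu t c k `](x - 1)%R, 0%R[%classic)%E.
    by apply: xk; [exact: open_itvoo|rewrite /= in_itv/=; lra].
  rewrite empty ?ltxx// => y /andP[_]; apply/negP; rewrite -leNgt.
  exact: distr_ge0 mu1 _.
have : (0 < defect_pushforward mu t c k `]1%R, (x + 1)%R[%classic)%E.
  by apply: xk; [exact: open_itvoo|rewrite /= in_itv/=; lra].
rewrite empty ?ltxx// => y /andP[+ _]; apply/negP; rewrite -leNgt.
exact: distr_le1 mu1 _.
Qed.

Lemma finite_IET_model : finite_set Cdef -> finite_IET_ae T.
Proof.
move=> /finite_seqP[s0 CdefE]; pose s := sort <=%R (undup s0).
have sP x : Cdef x <-> x \in s by rewrite CdefE mem_sort mem_undup.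
have ss : sorted <%R s by rewrite sort_lt_sorted undup_uniq.
pose t' := nth 1 s; pose N := (size s).-1.
have s1 : (1 < size s)%N.
  rewrite ltnNge; apply/negP => s1; have := (sP 0).1 defect_cut_set0.
  have := (sP 1).1 defect_cut_set1; case: (s) s1 => [|x [|//]] //= _.
  by rewrite !inE => /eqP <-; rewrite eq_sym oner_eq0.
have sN : (size s = N.+1)%N by rewrite /N prednK// ltnW.
have tlt k l : (k < l)%N -> (l <= N)%N -> t' k < t' l.
  move=> kl lN; apply: (sorted_ltn_nth lt_trans _ ss) => //; rewrite inE sN ltnS//.
  exact: leq_trans (ltnW kl) lN.
have tmem k : (k <= N)%N -> Cdef (t' k) by move=> kN; apply/sP/mem_nth; rewrite sN ltnS.
have t01 k : (k <= N)%N -> 0 <= t' k <= 1.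
  by move=> /tmem/defect_cut_set_unitC; rewrite /unitC/= in_itv.
have tidx x : Cdef x -> exists2 k, (k <= N)%N & t' k = x.
  move=> /sP xs; exists (index x s); last exact: nth_index.
  by rewrite -ltnS -sN index_mem.
have t0 : t' 0%N = 0.
  have [k kN kE] := tidx _ defect_cut_set0; case: k => [|k] in kN kE *; first by [].
  by have := tlt 0%N k.+1 isT kN; have /andP[+ _] := t01 0%N isT; rewrite kE; lra.
have tN : t' N = 1.
  have [k kN kE] := tidx _ defect_cut_set1.
  have := kN; rewrite leq_eqVlt => /predU1P[<- //|kN'].
  by have := tlt k N kN' (leqnn N); have /andP[_] := t01 N (leqnn N); rewrite kE; lra.
have tC k : (k < N)%N -> `]t' k, t' k.+1[%classic `<=` unitC.
  move=> kN x; have /andP[? _] := t01 k (ltnW kN); have /andP[_ ?] := t01 _ kN.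
  by rewrite /unitC/= !in_itv/=; lra.
have /choice[d dP] k : exists d, (k < N)%N ->
    forall u, (h @` X) u -> t' k < u < t' k.+1 -> T u = u + d.
  have [kN|_] := ltnP k N; last by exists 0.
  have [||d dP] := model_translation ustar itm inv mu_atom dom (tlt _ _ (ltnSn k) kN).
  - exact: tC.
  - apply/seteqP; split => // x []; rewrite /= in_itv/= => /andP[kx xk] /tidx[l lN lE].
    move: kx xk; rewrite -lE => kl lk.
    have [kl'|lk'|kl'] := ltngtP k l.
    + move: (kl'); rewrite leq_eqVlt => /predU1P[E|/tlt/(_ lN)]; last lra.
      by move: lk; rewrite E ltxx.
    + by have := tlt _ _ lk' (ltnW kN); lra.
    + by move: kl; rewrite kl' ltxx.
  by exists d.
have bds k : (k < N)%N -> 0 <= t' k + d k /\ t' k.+1 + d k <= 1.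
  move=> kN; apply: (model_translation_bounds itm inv mu_atom dom ustar01).
  - exact: tlt.
  - exact: tC.
  - exact: dP.
(* The exchange must be a total function: [br x] is the index of the branch containing [x], and 0
   off the branches. *)
pose br x := xget 0%N [set k | (k < N)%N /\ branch t' k x].
have brE k x : (k < N)%N -> branch t' k x -> br x = k.
  move=> kN kx; rewrite /br; apply: xget_unique => // l [lN lx].
  move: kx lx; rewrite /branch/= !in_itv/= => /andP[kx xk] /andP[lx xl].
  have [kl|lk|//] := ltngtP l k.
    have : t' l.+1 <= t' k by move: kl; rewrite leq_eqVlt => /predU1P[->//|/tlt/(_ (ltnW kN))/ltW].
    by move=> /(lt_le_trans xl)/lt_le_trans/(_ kx); rewrite ltxx.
  have : t' k.+1 <= t' l by move: lk; rewrite leq_eqVlt => /predU1P[->//|/tlt/(_ (ltnW lN))/ltW].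
  by move=> /(lt_le_trans xk)/lt_le_trans/(_ lx); rewrite ltxx.
have itm' : is_ITM N t' d (fun x => x + d (br x)).
  split => // [k kN|k x kN kx]; first exact: tlt.
  rewrite (brE k)//; split => //; have := bds _ kN; move: kx.
  by rewrite /branch/= in_itv/=; lra.
exists N, t', d, (fun x => x + d (br x)); split.
  split=> // x y /(itm_branchP itm' x).1[k kN kx] /(itm_branchP itm' y).1[l lN ly] ne.
  rewrite (brE k)// (brE l)// => E.
  have inner z m : (m < N)%N -> branch t' m z -> z != t' m -> t' m < z < t' m.+1.
    rewrite /branch/= in_itv/= => mN /andP[mz ->] zm.
    by rewrite lt_neqAle eq_sym zm mz.
  have [xk _] := ne k (ltnW kN); have [_ yl] := ne l (ltnW lN).
  have xk' := inner _ _ kN kx xk; have yl' := inner _ _ lN ly yl.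
  (* Injectivity is required at every point off the endpoints, not almost everywhere. A common image
     is interior to both translated branches, so the branches meet and [k = l]. *)
  have [||v [vk vl]] := model_translation_disjoint (w := x + d k) itm inv mu_atom dom
    (tC _ kN) (tC _ lN) (dP _ kN) (dP _ lN).
  - by rewrite !ltrD2r.
  - by rewrite E !ltrD2r.
  have kl : k = l.
    rewrite -(brE k v kN); last by rewrite /branch/= in_itv/=; lra.
    by apply: brE => //; rewrite /branch/= in_itv/=; lra.
  by move: E; rewrite kl => /addIr.
(* [dP] is silent at the left ends of the branches; these are cuts and are discarded as a null
   set. *)
have aeC : {ae lebesgue_measure, forall u : R, ~ Cdef u}.
  exists Cdef; split.
  - by apply: closed_measurable; exact: closed_defect_cut_set.
  - by apply: countable_lebesgue_measure0; apply: finite_set_countable; rewrite CdefE.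
  - by move=> u /contrapT.
have [M [mM M0 YM]] := ae_and aeC (ae_distr_image itm inv mu_atom dom).
exists M; split => // u nTu; apply: YM => -[nCu Yu]; apply: nTu => Iu.
have [k kN ku] := (itm_branchP itm' u).1 Iu.
rewrite (brE k)//; apply: dP => //.
  by apply: Yu; move: Iu; rewrite /unitI/unitC/= !in_itv/= => /andP[-> /ltW].
move: ku; rewrite /branch/= in_itv/= le_eqVlt => /andP[/predU1P[uE|->] ->//].
by exfalso; apply: nCu; rewrite -uE; apply: tmem; exact: ltnW.
Qed.

End exchange.

(** * Flat and jumping parts of a branch *)

Section active_gaps.
Context {R : realType} (n : nat) (t c : nat -> R) (S : R -> R).
Context (mu : probability (measurableTypeR R) R).
Hypotheses (itm : is_ITM n t c S) (inv : invariant_probability S mu).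
Hypotheses (mu_atom : nonatomic mu).
Local Notation h := (distr mu).
Local Notation mu1 := (proj1 inv).
Local Notation rho := (defect_pushforward mu t c).
Context (k : nat).
Hypothesis kn : (k < n)%N.
Local Notation g x := (h (x + c k) - h x).

Lemma defect_pushforward_nd (A B : set R) : measurable A -> measurable B ->
  A `<=` B -> (rho k A <= rho k B)%E.
Proof.
have mh (E : set R) : measurable E -> measurable (h @^-1` E `&` branch t k : set R).
  move=> mE; apply: measurableI; last exact: measurable_itv.
  rewrite -[X in measurable X]setTI.
  by have := distr_measurable mu1; exact.
move=> mA mB AB; apply: (le_defect_measure itm inv) => //; [exact: mh|exact: mh|].
by move=> x [? ?]; split => //; exact: AB.
Qed.

Lemma msupp_defect_bounds (x : R) : msupp (rho k) x -> h (t k) <= x <= h (t k.+1).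
Proof.
have empty (a b : R) : (forall y, branch t k y -> ~ a < h y < b) ->
    rho k `]a, b[%classic = 0%E.
  move=> hab; rewrite /defect_pushforward (_ : _ `&` _ = set0).
    by rewrite /defect_measure image_set0 measure0 subee.
  by apply/seteqP; split => // y [/=]; rewrite in_itv/= => yab /hab.
move=> xs; apply/andP; split; rewrite leNgt; apply/negP => ?.
  have : (0 < rho k `](x - 1)%R, (h (t k))%R[%classic)%E.
    by apply: xs; [exact: open_itvoo|rewrite /= in_itv/=; lra].
  rewrite empty ?ltxx// => y; rewrite /branch/= in_itv/= => /andP[/(distr_nd mu1) ky _].
  by move=> /andP[_]; rewrite ltNge ky.
have : (0 < rho k `](h (t k.+1))%R, (x + 1)%R[%classic)%E.
  by apply: xs; [exact: open_itvoo|rewrite /= in_itv/=; lra].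
rewrite empty ?ltxx// => y; rewrite /branch/= in_itv/= => /andP[_ /ltW/(distr_nd mu1) yk].
by move=> /andP[+ _]; rewrite ltNge yk.
Qed.

Lemma msupp_defect_flat (p q x : R) : t k <= p -> p <= q -> q <= t k.+1 ->
  g p = g q -> h p < x < h q -> ~ msupp (rho k) x.
Proof.
move=> kp pq qk gpq pxq /(_ `]h p, h q[%classic (@open_itvoo R _ _)).
rewrite /= in_itv/= => /(_ pxq); apply/negP; rewrite -leNgt.
apply: (le_trans (defect_pushforward_le_itvoo itm inv mu_atom kn kp pq qk)).
rewrite lee_fin; lra.
Qed.

(** The interval []p, q[] is null while its translate is charged, and [h] collapses it to one value,
    at which [rho k] therefore has a point mass. *)
Lemma msupp_defect_jump (p q : R) : t k <= p -> p <= q -> q <= t k.+1 ->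
  h p = h q -> g p < g q -> msupp (rho k) (h p).
Proof.
move=> kp pq qk hpq gpq U oU Up.
have [e e0 eU] := nbhs_itvoo (open_nbhs_nbhs (conj oU Up)).
apply: (@lt_le_trans _ _ (rho k `](h p - e)%R, (h p + e)%R[%classic)); last first.
  by apply: defect_pushforward_nd => //; exact: open_measurable.
apply: (lt_le_trans _ (defect_itvoo_le_pushforward itm inv mu_atom kn kp pq qk _ _)).
- rewrite lte_fin; lra.
- lra.
- lra.
Qed.

(** The null interval []p, q[] lies in one branchwise gap [G], which inherits a charged translate;
    the cut [h (inf G)] has to be identified with [h p]. *)
Lemma active_gap_cut_jump (p q : R) : t k <= p -> p <= q -> q <= t k.+1 ->
  h p = h q -> g p < g q -> active_gap_cut mu n t c (h p).
Proof.
move=> kp pq qk hpq gpq; have {}pq : p < q.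
  by rewrite lt_neqAle pq andbT; apply/eqP => E; move: gpq; rewrite E ltxx.
pose w := (p + q) / 2; pose D := `]t k, t k.+1[%classic `\` msupp mu.
have pq0 : mu `]p, q[%classic = 0%E by rewrite (mu_itvoo mu1 mu_atom (ltW pq)) hpq subrr.
have pqD : `]p, q[%classic `<=` D.
  move=> y; rewrite /= in_itv/= => /andP[py yq]; split.
    by rewrite /= in_itv/= (le_lt_trans kp py) (lt_le_trans yq qk).
  by apply: itvoo_null_off_msupp pq0 _; rewrite py yq.
have pqw : `]p, q[%classic w by rewrite /= in_itv/= /w; lra.
exists k, w => /=; set G := connected_component _ _.
have pqG : `]p, q[%classic `<=` G.
  apply: connected_component_max => //.
  by apply/connected_intervalP/interval_is_interval.
have iG : is_interval G by apply/connected_intervalP; exact: component_connected.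
have GD : G `<=` D by exact: connected_component_sub.
have mG : measurable (G : set R) := is_interval_measurable iG.
have infG : has_inf G.
  split; first by exists w; exact: pqG.
  by exists (t k) => y /GD[]; rewrite /= in_itv/= => /andP[/ltW].
split => //; first exact: pqD.
  apply: (@lt_le_trans _ _ (mu [set y + c k | y in `]p, q[%classic])).
    rewrite image_translate_itvoo (mu_itvoo mu1 mu_atom) ?lerD2r ?ltW// lte_fin; lra.
  apply: le_measure; rewrite ?inE.
  - by apply: measurable_image_translate; exact: measurable_itv.
  - exact: measurable_image_translate.
  - by move=> _ [y ypq <-]; exists y => //; exact: pqG.
have iw : inf G <= w by apply: ge_inf; [exact: infG.2|exact: pqG].
(* [inf G] may lie to the left of [p]. The stretch from it to the midpoint [w] stays in [G], off the
   support, so [h] is unchanged along it. *)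
have iwG : `]inf G, w[%classic `<=` G.
  move=> y; rewrite /= in_itv/= => /andP[iy yw].
  have [z Gz zy] := inf_adherent (eps := y - inf G) ltac:(by rewrite subr_gt0) infG.
  by apply: (iG z w) => //; [exact: pqG|move: zy; rewrite addrC subrK => /ltW ->; exact: ltW].
have iw0 : mu `]inf G, w[%classic = 0%E.
  apply/eqP; rewrite eq_le measure_ge0 andbT -(mu_setC_msupp mu); apply: le_measure; rewrite ?inE//.
  - by apply: measurableC; apply: closed_measurable; exact: closed_msupp.
  - by move=> y /iwG/GD[].
have hiw : h w = h (inf G).
  by apply/eqP; rewrite -subr_eq0; move: iw0; rewrite (mu_itvoo mu1 mu_atom iw) => -[->].
rewrite -hiw; apply/eqP; rewrite eq_le; apply/andP; split.
  by apply: (distr_nd mu1); rewrite /w; lra.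
by rewrite hpq; apply: (distr_nd mu1); rewrite /w; lra.
Qed.

End active_gaps.

Lemma measure_setU3 {R : realType} (mu : measure (measurableTypeR R) R)
    (A B C : set R) :
  measurable A -> measurable B -> measurable C ->
  A `&` B = set0 -> (A `|` B) `&` C = set0 ->
  mu (A `|` B `|` C) = (mu A + mu B + mu C)%E.
Proof.
by move=> mA mB mC AB ABC; rewrite measureU//; [rewrite measureU|exact: measurableU].
Qed.

Lemma measurable_itv_preimage {R : realType} (p r : R) (f : R -> R) (B : set R) :
  {homo f : x y / x <= y} -> measurable B ->
  measurable [set x | p <= x < r /\ B (f x)].
Proof.
move=> fnd mB; have mf : measurable_fun setT f by exact: nondecreasing_measurable.
rewrite (_ : [set x | _] = `[p, r[%classic `&` (setT `&` f @^-1` B)).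
  by apply: measurableI; [exact: measurable_itv|exact: mf].
by rewrite setTI; apply/seteqP; split => x /=; rewrite in_itv.
Qed.

(** * The stationary Bruin-Troubetzkoy map *)

Section bruin_troubetzkoy.
Context {R : realType} (a b : R).
Hypotheses (a12 : 0 < a < 1 / 2) (root_a : a ^+ 3 - a ^+ 2 - 2 * a + 1 = 0).
Hypothesis bE : b = a ^+ 2.
Local Notation S := (BT_map a b).
Local Notation t := (BT_t a b).
Local Notation c := (BT_c a b).
Local Notation q := (1 - 2 * a + b).

Lemma BT_aa : a * a = b. Proof. by rewrite bE expr2. Qed.

(** The cubic equation as a rule that makes the product [a * b] linear. With the companion rules for
    [a * a], [b * (1 - a)] and [a * q], most comparisons below are linear. *)
Lemma BT_ab : a * b = b + 2 * a - 1.
Proof. by apply: subr0_eq; rewrite -root_a bE; ring. Qed.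

Lemma BT_bc : b * (1 - a) = 1 - 2 * a.
Proof. by rewrite mulrBr mulr1 [b * a]mulrC BT_ab; ring. Qed.

Lemma BT_aq : a * q = a - q.
Proof. by rewrite mulrDr mulrBr mulrCA BT_aa BT_ab; ring. Qed.

Lemma BT_order : [/\ 0 < b, b < a, a < 1 / 2, 0 < b + 2 * a - 1 & 0 < a].
Proof.
case/andP: a12 => a0 a1; have b0 : 0 < b by rewrite -BT_aa mulr_gt0.
split => //; first by rewrite -BT_aa gtr_pMr//; lra.
by rewrite -BT_ab mulr_gt0.
Qed.

Lemma BT_itm : is_ITM 3 t c S.
Proof.
have [? ? ? ? ?] := BT_order.
split => // [[|[|[|//]]]|] /=.
- by move=> _; rewrite /BT_t/=; lra.
- by move=> _; rewrite /BT_t/=; lra.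
- by move=> _; rewrite /BT_t/=; lra.
move=> [|[|[|//]]] x _; rewrite /branch /BT_t /BT_c /BT_map/= in_itv/= => /andP[x0 x1].
- by rewrite x1; split => //; lra.
- by rewrite ltNge x0/= x1; split => //; lra.
- rewrite ltNge [1 - a <= x](_ : _ = true)/=; last by apply/idP; lra.
  by rewrite ltNge x0/=; split; lra.
Qed.

Section stationary.
Context (mu : probability (measurableTypeR R) R).
Hypothesis inv : invariant_probability S mu.

Definition BT_pre1 (B : set R) := [set x : R | 0 <= x < 1 - a /\ B (x + a)].
Definition BT_pre2 (B : set R) := [set x : R | 1 - a <= x < 1 - b /\ B (x + b)].
Definition BT_pre3 (B : set R) := [set x : R | 1 - b <= x < 1 /\ B (x + b - 1)].

Lemma measurable_BT_pre1 (B : set R) : measurable B -> measurable (BT_pre1 B).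
Proof. by apply: measurable_itv_preimage => x y; lra. Qed.

Lemma measurable_BT_pre2 (B : set R) : measurable B -> measurable (BT_pre2 B).
Proof. by apply: measurable_itv_preimage => x y; lra. Qed.

Lemma measurable_BT_pre3 (B : set R) : measurable B -> measurable (BT_pre3 B).
Proof. by apply: measurable_itv_preimage => x y; lra. Qed.

Lemma BT_preimage (B : set R) : unitI `&` S @^-1` B = BT_pre1 B `|` BT_pre2 B `|` BT_pre3 B.
Proof.
have [? ? ? ? ?] := BT_order.
apply/seteqP; split => x.
  rewrite /unitI /BT_pre1 /BT_pre2 /BT_pre3 /BT_map/= in_itv/= => -[/andP[x0 x1]].
  case: (ltP x (1 - a)) => xa; first by left; left; rewrite x0.
  case: (ltP x (1 - b)) => xb; first by left; right.
  by right.
rewrite /unitI /BT_pre1 /BT_pre2 /BT_pre3 /BT_map/= in_itv/=.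
move=> [[[/andP[x0 xa] Bx]|[/andP[x0 xa] Bx]]|[/andP[x0 xa] Bx]].
- by split; [lra|rewrite xa].
- by split; [lra|rewrite [x < 1 - a]ltNge x0/= xa].
- split; first lra.
  rewrite [x < 1 - a](_ : _ = false); last by apply/negbTE; rewrite -leNgt; lra.
  by rewrite [x < 1 - b]ltNge x0.
Qed.

Lemma BT_mu_split (B : set R) : measurable B ->
  mu B = (mu (BT_pre1 B) + mu (BT_pre2 B) + mu (BT_pre3 B))%E.
Proof.
have [? ? ? ? ?] := BT_order.
move=> mB; rewrite -inv.2// BT_preimage measure_setU3//.
- exact: measurable_BT_pre1.
- exact: measurable_BT_pre2.
- exact: measurable_BT_pre3.
- by apply/seteqP; split => // x [[/andP[_ ?] _] [/andP[? _] _]]; exfalso; lra.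
- apply/seteqP; split => // x [[[/andP[_ ?] _]|[/andP[_ ?] _]] [/andP[? _] _]]; exfalso; lra.
Qed.

(* The first return map of [S] to [`[1 - a, 1[] is conjugate to [S] by this
   affine map, by the cubic equation for [a]. *)
Definition BT_zoom (x : R) := (x - 1 + a) / a.
Definition BT_zoom_preimage (B : set R) := [set x : R | 1 - a <= x < 1 /\ B (BT_zoom x)].

Lemma BT_zoomE (x z : R) : (BT_zoom x = z) <-> (x = 1 - a + a * z).
Proof.
have [? ? ? ? a0] := BT_order; rewrite /BT_zoom.
split => [<-|->]; first by field; rewrite gt_eqF.
by field; rewrite gt_eqF.
Qed.

Lemma BT_zoomK (x : R) : x = 1 - a + a * BT_zoom x. Proof. exact/BT_zoomE. Qed.

Lemma BT_zoom_nd : {homo BT_zoom : x y / x <= y}.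
Proof.
by have [? ? ? ? a0] := BT_order; move=> x y xy; rewrite /BT_zoom ler_pM2r ?invr_gt0//; lra.
Qed.

Lemma measurable_BT_zoom_preimage (B : set R) : measurable B -> measurable (BT_zoom_preimage B).
Proof. by apply: measurable_itv_preimage; exact: BT_zoom_nd. Qed.

Lemma BT_zoomD (x d : R) : BT_zoom (x + a * d) = BT_zoom x + d.
Proof. by apply/BT_zoomE; rewrite mulrDr addrA -BT_zoomK. Qed.

Lemma BT_zoom_lt (x w : R) : (BT_zoom x < w) = (x < 1 - a + a * w).
Proof.
have [? ? ? ? a0] := BT_order; rewrite {2}[x]BT_zoomK ltrD2l ltr_pM2l//.
Qed.

Lemma BT_zoom_ge (x w : R) : (w <= BT_zoom x) = (1 - a + a * w <= x).
Proof. by rewrite !leNgt BT_zoom_lt. Qed.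

(** Pulling [C] back by invariance until it has left [[1 - a, 1[] and come back splits its mass by
    return time: [BT_pre2 C] returns in one step, [BT_pre3 D] in two (third branch, then first),
    [BT_pre3 E] in three (third, then first twice). In the zoomed coordinate these are branches one,
    three and two, since the total translations are [b = a * a], [b - 1 + a = a * (b - 1)] and
    [b - 1 + 2 * a = a * b]. *)
Lemma BT_mu_first_return (B : set R) : measurable B ->
  mu (BT_zoom_preimage (unitI `&` S @^-1` B)) = mu (BT_zoom_preimage B).
Proof.
have [? ? ? ? a0] := BT_order => mB.
have ? := BT_ab; have ? := BT_aa.
have mC := measurable_BT_zoom_preimage mB; set C := BT_zoom_preimage B in mC *.
have mD := measurable_BT_pre1 mC; set D := BT_pre1 C in mD.
have mE := measurable_BT_pre1 mD; set E := BT_pre1 D in mE.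
have C3 : BT_pre3 C = set0.
  by apply/seteqP; split => // x [/andP[? ?] [/andP[? ?] _]]; exfalso; lra.
have D2 : BT_pre2 D = set0.
  by apply/seteqP; split => // x [/andP[? ?] [/andP[? ?] _]]; exfalso; lra.
have E1 : BT_pre1 E = set0.
  by apply/seteqP; split => // x [/andP[? ?] [/andP[? ?] [/andP[? ?] _]]]; exfalso; lra.
have E2 : BT_pre2 E = set0.
  by apply/seteqP; split => // x [/andP[? ?] [/andP[? ?] [/andP[? ?] _]]]; exfalso; lra.
have muC : mu C = (mu (BT_pre3 E) + mu (BT_pre3 D) + mu (BT_pre2 C))%E.
  by rewrite (BT_mu_split mC) C3 measure0 adde0 -/D (BT_mu_split mD) D2 -/E
    (BT_mu_split mE) E1 E2 !measure0 adde0 !add0e.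
have Z1 : BT_zoom_preimage (BT_pre1 B) = BT_pre2 C.
  rewrite /BT_pre2 /C /BT_zoom_preimage /BT_pre1; apply/seteqP; split => x /=;
    rewrite BT_zoom_lt BT_zoom_ge (_ : BT_zoom (x + b) = BT_zoom x + a) -?BT_zoomD ?BT_aa//.
    by move=> [xL [xz Bx]]; split; [|split => //]; lra.
  by move=> [xz [xL Bx]]; split; [|split => //]; lra.
have Z2 : BT_zoom_preimage (BT_pre2 B) = BT_pre3 E.
  rewrite /E /D /BT_pre1 /BT_pre3 /BT_pre2 /C /BT_zoom_preimage;
    apply/seteqP; split => x /=; rewrite BT_zoom_lt BT_zoom_ge.
    rewrite (_ : x + b - 1 + a + a = x + a * b); last by lra.
    by rewrite BT_zoomD => -[xL [xz Bx]]; do !split => //; lra.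
  rewrite (_ : x + b - 1 + a + a = x + a * b); last by lra.
  by rewrite BT_zoomD => -[? [? [? [? ?]]]]; do !split => //; lra.
have Z3 : BT_zoom_preimage (BT_pre3 B) = BT_pre3 D.
  rewrite /D /BT_pre1 /BT_pre3 /C /BT_zoom_preimage;
    apply/seteqP; split => x /=; rewrite BT_zoom_lt BT_zoom_ge.
    rewrite (_ : x + b - 1 + a = x + a * (b - 1)); last by lra.
    by rewrite BT_zoomD addrA => -[xL [xz Bx]]; do !split => //; lra.
  rewrite (_ : x + b - 1 + a = x + a * (b - 1)); last by lra.
  by rewrite BT_zoomD addrA => -[? [? [? ?]]]; do !split => //; lra.
rewrite BT_preimage (_ : BT_zoom_preimage _ = BT_zoom_preimage (BT_pre1 B) `|`
    BT_zoom_preimage (BT_pre2 B) `|` BT_zoom_preimage (BT_pre3 B)); last first.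
  apply/seteqP; split => x; first by move=> [xL [[?|?]|?]]; [left; left|left; right|right].
  by move=> [[[xL ?]|[xL ?]]|[xL ?]]; split => //; [left; left|left; right|right].
rewrite measure_setU3;
  [|exact: (measurable_BT_zoom_preimage (measurable_BT_pre1 mB))
   |exact: (measurable_BT_zoom_preimage (measurable_BT_pre2 mB))
   |exact: (measurable_BT_zoom_preimage (measurable_BT_pre3 mB))| |].
- by rewrite Z1 Z2 Z3 muC -addeA addeC.
- by apply/seteqP; split => // x [[_ [/andP[_ ?] _]] [_ [/andP[? _] _]]]; exfalso; lra.
- apply/seteqP; split => // x [[[_ [/andP[_ ?] _]]|[_ [/andP[_ ?] _]]] [_ [/andP[? _] _]]];
    exfalso; lra.
Qed.

End stationary.
End bruin_troubetzkoy.

(** * Functional equations of the stationary distribution function *)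

Lemma mnormalizeE {d} {T : measurableType d} {R : realType} (nu : measure T R)
    (P : probability T R) (m : R) (A : set T) :
  0 < m -> nu setT = m%:E -> mnormalize nu P A = (nu A * m^-1%:E)%E.
Proof. by move=> m0 nuT; rewrite /mnormalize nuT/= orbF eqe gt_eqF. Qed.

Section stationary_distribution.
Context {R : realType} (a b : R).
Hypotheses (a12 : 0 < a < 1 / 2) (root_a : a ^+ 3 - a ^+ 2 - 2 * a + 1 = 0).
Hypothesis bE : b = a ^+ 2.
Context (mu : probability (measurableTypeR R) R).
Hypothesis inv : invariant_probability (BT_map a b) mu.
Hypothesis uniq : forall nu : probability (measurableTypeR R) R,
  invariant_probability (BT_map a b) nu ->
  forall B : set R, measurable B -> nu B = mu B.
Hypothesis mu_atom : nonatomic mu.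
Local Notation h := (distr mu).
Local Notation mu1 := (proj1 inv).
Local Notation q := (1 - 2 * a + b).
Local Notation order := (BT_order a12 root_a bE).

Let mu_itvco (p r : R) : p <= r -> mu `[p, r[%classic = (h r - h p)%:E.
Proof. exact: (@mu_itv _ _ mu1 mu_atom p r true true). Qed.

Let mu_initial (y : R) : mu `[0, y[%classic = (h y)%:E.
Proof.
have h0 := distr_le0 mu1 mu_atom (lexx 0).
have [y0|/ltW y0] := leP 0 y; first by rewrite mu_itvco// h0 subr0.
by rewrite (distr_le0 mu1 mu_atom y0) set_itv_ge ?measure0// bnd_simp -leNgt.
Qed.

(** Invariance applied to [[0, y[], one term per branch. The maximum and the minimum clip the
    preimage to its branch; the first term needs no clip because [h] vanishes on negative numbers
    and [y - a <= 1 - a]. *)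
Lemma distr_BT (y : R) : 0 <= y <= 1 ->
  h y = h (y - a) + (h (Num.max (1 - a) (y - b)) - h (1 - a)) +
        (h (Num.min 1 (y + 1 - b)) - h (1 - b)).
Proof.
have [? ? ? ? ?] := order => /andP[y0 y1]; apply: EFin_inj.
rewrite -mu_initial (BT_mu_split a12 root_a bE inv); last exact: measurable_itv.
rewrite !EFinD; congr (_ + _ + _)%E.
- rewrite -mu_initial; congr (mu _); apply/seteqP; split => x; rewrite /BT_pre1/= !in_itv/=; lra.
- rewrite -EFinD -mu_itvco; last by rewrite le_max lexx.
  congr (mu _); apply/seteqP; split => x; rewrite /BT_pre2/= !in_itv/= lt_max.
    move=> [/andP[x0 _] /andP[_ xy]]; rewrite x0 /=.
    by apply/orP; right; rewrite ltrBrDr.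
  by move=> /andP[x0 /orP[]] ?; split; lra.
- rewrite -EFinD -mu_itvco; last by rewrite le_min; lra.
  congr (mu _); apply/seteqP; split => x; rewrite /BT_pre3/= !in_itv/= lt_min; lra.
Qed.

Lemma distr_BT_le_b (y : R) : 0 <= y <= b -> h y = h (y + 1 - b) - h (1 - b).
Proof.
have [? ? ? ? ?] := order => y0b; rewrite distr_BT; last lra.
rewrite (distr_le0 mu1 mu_atom (_ : y - a <= 0)); last lra.
by rewrite max_l ?min_r; [ring|lra|lra].
Qed.

(** The branches have images [[a, 1[], [[1 - a + b, 1[] and [[0, b[], so nothing lands in [[b,
    a[]. *)
Lemma distr_BT_gap (y : R) : b <= y <= a -> h y = 1 - h (1 - b).
Proof.
have [? ? ? ? ?] := order => y0b; rewrite distr_BT; last lra.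
rewrite (distr_le0 mu1 mu_atom (_ : y - a <= 0)); last lra.
rewrite max_l ?min_l; [|lra|lra].
by rewrite (distr_ge1 mu1 (lexx 1)); ring.
Qed.

Lemma distr_BT_middle (y : R) : a <= y <= 1 - a + b ->
  h y = h (y - a) + (1 - h (1 - b)).
Proof.
have [? ? ? ? ?] := order => y0b; rewrite distr_BT; last lra.
rewrite max_l ?min_l; [|lra|lra].
by rewrite (distr_ge1 mu1 (lexx 1)); ring.
Qed.

Lemma distr_BT_overlap (y : R) : 1 - a + b <= y <= 1 ->
  h y = h (y - a) + (h (y - b) - h (1 - a)) + (1 - h (1 - b)).
Proof.
have [? ? ? ? ?] := order => y0b; rewrite distr_BT; last lra.
rewrite max_r ?min_l; [|lra|lra].
by rewrite (distr_ge1 mu1 (lexx 1)).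
Qed.

(* If [`[1 - a, 1[] were null, so would be its preimage [`[1 - 2 * a, 1 - a[];
   but [`[0, 1 - 2 * a[] is only reached from the last branch. *)
Lemma distr_BT_lt1 : h (1 - a) < 1.
Proof.
have [? ? ? ? ?] := order.
rewrite lt_neqAle (distr_le1 mu1) andbT; apply/eqP => h1.
have h1b : h (1 - b) = 1.
  apply/le_anti; rewrite (distr_le1 mu1)/= -h1; apply: (distr_nd mu1); lra.
have := distr_BT_middle (y := 1 - a) ltac:(lra).
rewrite h1 h1b subrr addr0 (_ : 1 - a - a = 1 - 2 * a); last by ring.
rewrite distr_BT_le_b; last lra.
have : h (1 - 2 * a + 1 - b) <= 1 by exact: distr_le1 mu1 _.
rewrite h1b; lra.
Qed.

(** The restriction of [mu] to [[1 - a, 1[], zoomed and normalized, is again an invariant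
    probability, so it is [mu] by unique ergodicity. *)
Lemma mu_BT_zoom_preimage (B : set R) : measurable B ->
  mu (BT_zoom_preimage a B) = (mu `[(1 - a)%R, 1%R[%classic * mu B)%E.
Proof.
have [? ? ? ? a0] := order => mB.
have L1 : mu `[1 - a, 1[%classic = (1 - h (1 - a))%:E.
  by rewrite mu_itvco ?(distr_ge1 mu1 (lexx 1))//; lra.
set m := 1 - h (1 - a) in L1.
have m0 : 0 < m by have := distr_BT_lt1; rewrite /m; lra.
have mL : measurable (`[1 - a, 1[%classic : set (measurableTypeR R)) by exact: measurable_itv.
pose z : measurableTypeR R -> measurableTypeR R := BT_zoom a.
have mz : measurable_fun setT z.
  by apply: nondecreasing_measurable => //; exact: BT_zoom_nd a12 root_a bE.
pose nu0' : measure (measurableTypeR R) R := pushforward (mrestr mu mL) z.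
pose nu0 := nu0' mz.
(* The argument [mu] is the fallback value of the normalization for total mass zero or infinite,
   excluded by [m0]. *)
pose nu : probability (measurableTypeR R) R := mnormalize nu0 mu.
have nu0E (C : set R) : nu0 C = mu (BT_zoom_preimage a C).
  rewrite /nu0 /= /pushforward /mrestr; congr (mu _).
  by apply/seteqP; split => x; rewrite /BT_zoom_preimage/= in_itv/= => -[].
have nuE (C : set R) : nu C = (nu0 C * m^-1%:E)%E.
  have nu0T : nu0 setT = m%:E.
    by rewrite nu0E -L1; congr (mu _); apply/seteqP; split => x;
      rewrite /BT_zoom_preimage/= in_itv/=; [case|].
  exact: mnormalizeE nu0T.
have nu_inv : invariant_probability (BT_map a b) nu.
  split.
    rewrite nuE nu0E (_ : BT_zoom_preimage a unitI = `[1 - a, 1[%classic).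
      by rewrite L1 -EFinM divff// gt_eqF.
    apply/seteqP; split => x; rewrite /BT_zoom_preimage /unitI/= !in_itv/=.
      by case.
    rewrite (BT_zoom_ge a12 root_a bE) (BT_zoom_lt a12 root_a bE); lra.
  by move=> C mC; rewrite !nuE !nu0E (BT_mu_first_return a12 root_a bE inv).
have := uniq nu_inv mB; rewrite nuE nu0E L1 => <-.
by rewrite muleCA -EFinM divff ?mule1// gt_eqF.
Qed.

Let distr_zoom0 (y : R) : 0 <= y <= 1 ->
  h (1 - a + a * y) = h (1 - a) + (1 - h (1 - a)) * h y.
Proof.
have [? ? ? ? a0] := order => /andP[y0 y1].
have ay : 0 <= a * y <= a by rewrite mulr_ge0 ?(ltW a0)//= ger_pMr.
have := @mu_BT_zoom_preimage `[0, y[%classic (measurable_itv _).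
rewrite mu_initial mu_itvco ?(distr_ge1 mu1 (lexx 1)); last lra.
rewrite (_ : BT_zoom_preimage _ _ = `[1 - a, 1 - a + a * y[%classic); last first.
  apply/seteqP; split => x; rewrite /BT_zoom_preimage/= !in_itv/=;
  rewrite (BT_zoom_ge a12 root_a bE) (BT_zoom_lt a12 root_a bE); lra.
rewrite mu_itvco; last lra.
by rewrite -EFinM => -[E]; rewrite -E; ring.
Qed.

Lemma distr_BT_t1 : h (1 - a) = a.
Proof.
have [? ? ? ? a0] := order; have aa := BT_aa bE; have ab := BT_ab root_a bE.
have e1 := distr_zoom0 (y := 1 - a) ltac:(lra).
have e2 := distr_zoom0 (y := 1 - b) ltac:(lra).
have e3 := distr_BT_middle (y := 1 - a) ltac:(lra).
have e4 := distr_BT_le_b (y := 1 - 2 * a) ltac:(lra).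
have h1 := distr_BT_lt1; have h0 := distr_ge0 mu1 (1 - a).
have E1 : 1 - a + a * (1 - a) = 1 - b by rewrite mulrBr aa; ring.
have E2 : 1 - a + a * (1 - b) = 1 - 2 * a + 1 - b by rewrite mulrBr ab; ring.
have E3 : 1 - a - a = 1 - 2 * a by ring.
move: e1 e2 e3 e4; rewrite E1 E2 E3 => e1 e2 e3 e4.
move: e4 e2 e3 h0 h1; rewrite e1; set H := h (1 - a) => -> -> e3 h0 h1.
pose m := 1 - H.
(* Both [m] and [1 - a] are roots of [x ^ 3 - 2 * x ^ 2 - x + 1], and this is the factored
   difference of the two equations. The second factor is negative when both arguments lie in []0,
   1]]. *)
have : (m - (1 - a)) * (m ^+ 2 + m * (1 - a) + (1 - a) ^+ 2 - 2 * (m + (1 - a)) - 1) = 0.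
  have : m ^+ 3 - 2 * m ^+ 2 - m + 1 = 0 by move: e3; rewrite /m; nra.
  move: root_a; nra.
move=> /eqP; rewrite mulf_eq0 => /orP[/eqP|/eqP E]; first by rewrite /m; lra.
exfalso; have : 0 < m <= 1 by rewrite /m; lra.
nra.
Qed.

Lemma distr_BT_zoom (y : R) : 0 <= y <= 1 -> h (1 - a + a * y) = a + (1 - a) * h y.
Proof. by move=> y01; rewrite distr_zoom0// distr_BT_t1. Qed.

Lemma distr_BT_t2 : h (1 - b) = 2 * a - b.
Proof.
have [? ? ? ? a0] := order; have aa := BT_aa bE.
rewrite (_ : 1 - b = 1 - a + a * (1 - a)); last by rewrite mulrBr aa; ring.
by rewrite distr_BT_zoom; [rewrite distr_BT_t1 mulrBl aa; ring|lra].
Qed.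

Let ab := BT_ab root_a bE.
Let aa := BT_aa bE.

Let mul_bounds (s y r : R) : 0 <= s -> 0 <= y <= r -> 0 <= s * y <= s * r.
Proof. by move=> s0 /andP[y0 yr]; rewrite mulr_ge0// ler_wpM2l. Qed.

(** [[0, b]] is fed by the last branch only, and [b * y + 1 - b] is the double zoom of [y]; each
    zoom contributes a factor [1 - a]. *)
Lemma distr_BT_scale (y : R) : 0 <= y <= 1 -> h (b * y) = q * h y.
Proof.
have [b0 ? ? ? a0] := order => y01.
have := mul_bounds (ltW b0) y01 => by01; have := mul_bounds (ltW a0) y01 => ay01.
rewrite distr_BT_le_b; last lra.
rewrite (_ : b * y + 1 - b = 1 - a + a * (1 - a + a * y)); last first.
  by rewrite mulrDr mulrBr mulrA aa; ring.
rewrite distr_BT_zoom; last lra.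
rewrite distr_BT_zoom// distr_BT_t2.
by rewrite -aa; ring.
Qed.

Lemma distr_BT_gapE (y : R) : b <= y <= a -> h y = q.
Proof. by move=> /distr_BT_gap ->; rewrite distr_BT_t2; ring. Qed.

Let bc := BT_bc root_a bE.
Let aq := BT_aq root_a bE.

Let ac : a * (1 - a) = a - b.
Proof. by rewrite mulrBr mulr1 aa. Qed.

Lemma distr_BT_shift (y : R) : 0 <= y <= 1 - a -> h (a + b * y) = q + q * h y.
Proof.
have [b0 ? ? ? a0] := order => y01.
have := mul_bounds (ltW b0) y01; rewrite bc => by01.
rewrite distr_BT_middle; last lra.
rewrite (_ : a + b * y - a = b * y); last by ring.
by rewrite distr_BT_scale ?distr_BT_t2; [ring|lra].
Qed.

Local Notation g x := (h (x + a) - h x).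

(** For these [x] the point [x + a] is at most [1 - a + b], below the image of the second branch, so
    no defect has accumulated yet. *)
Lemma BT_gap_flat (x : R) : 0 <= x <= q -> g x = q.
Proof.
have [b0 ? ? ? a0] := order => xq; rewrite distr_BT_middle ?addrK; last lra.
by rewrite distr_BT_t2; ring.
Qed.

(** Beyond [q] the images of the first two branches overlap. The surplus is the mass of the second
    branch below [x + a - b], which equals [1 - a + a * w], a zoomed initial segment. *)
Lemma BT_gap_zoom (w : R) : 0 <= w <= 1 - a -> g (q + a * w) = q + (1 - a) * h w.
Proof.
have [b0 ? ? ? a0] := order => w01.
have := mul_bounds (ltW a0) w01; rewrite ac => aw.
rewrite distr_BT_overlap ?addrK; last lra.
rewrite (_ : q + a * w + a - b = 1 - a + a * w); last by ring.
by rewrite distr_BT_zoom ?distr_BT_t1 ?distr_BT_t2; [ring|lra].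
Qed.

(** Self-similarity of the defect with ratio [q]. Since [a + b * z = q + a * (q + a * z)], the zoom
    formula expresses [g (a + b * z)] by [h (q + a * z)]. For [z <= q] the argument lies in the gap
    [[b, a]], where [h] is constant; for [z = q + a * w] it is [a + b * w], where the shift equation
    of [h] applies. *)
Lemma BT_gap_shift (y : R) : 0 <= y <= 1 - a ->
  g (a + b * y) = g a + q * (g y - q).
Proof.
have [b0 ? ? ? a0] := order => y01.
have gz (z : R) : 0 <= z <= 1 - a -> g (a + b * z) = q + (1 - a) * h (q + a * z).
  move=> z01; have := mul_bounds (ltW a0) z01; rewrite ac => az.
  rewrite -BT_gap_zoom; last lra.
  by rewrite (_ : q + a * (q + a * z) = a + b * z)// mulrDr mulrA aa aq; ring.
have gflat (z : R) : 0 <= z <= q -> g (a + b * z) = q + (1 - a) * q.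
  move=> zq; have := mul_bounds (ltW a0) zq; rewrite aq => az.
  by rewrite gz ?(@distr_BT_gapE (q + a * z)); [|lra|lra].
have ga : g a = q + (1 - a) * q by rewrite -(gflat 0) ?mulr0 ?addr0//; lra.
have [yq|qy] := leP y q.
  by rewrite (gflat y) ?(@BT_gap_flat y) ?ga; [ring|lra|lra].
pose w := (y - q) / a; have yw : y = q + a * w.
  by rewrite /w mulrCA divff ?gt_eqF// mulr1; ring.
have w0 : 0 <= w <= 1 - a.
  apply/andP; split; first by rewrite divr_ge0 ?subr_ge0 ?ltW.
  by rewrite ler_pdivrMr// [(1 - a) * a]mulrC ac; lra.
rewrite gz// yw (BT_gap_zoom w0) [a * (q + _)]mulrDr aq mulrA aa.
rewrite (_ : q + (a - q + b * w) = a + b * w); last by ring.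
by rewrite distr_BT_shift// ga; ring.
Qed.

End stationary_distribution.

(** * Defects carried by a sequence of gaps *)

Lemma expr_small {R : realType} (z e : R) : 0 <= z < 1 -> 0 < e -> exists n, z ^+ n < e.
Proof.
move=> /andP[z0 z1] e0; have : z ^+ n @[n --> \oo] --> (0 : R).
  by apply: cvg_expr; rewrite ger0_norm.
move=> /cvgrPdist_lt/(_ _ e0)[n _ /(_ n (leqnn n))] /=.
by rewrite sub0r normrN ger0_norm ?exprn_ge0//; exists n.
Qed.

Section defect_sequence.
Context {R : realType} (n : nat) (t c : nat -> R) (S : R -> R).
Context (mu : probability (measurableTypeR R) R).
Hypotheses (itm : is_ITM n t c S) (inv : invariant_probability S mu).
Hypotheses (mu_atom : nonatomic mu).
Local Notation h := (distr mu).
Context (k : nat) (x y : nat -> R).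
Local Notation g x := (h (x + c k) - h x).
Hypotheses (kn : (k < n)%N) (x0 : x 0%N = t k).
Hypothesis xy : forall r, t k <= x r /\ x r <= y r /\ y r <= x r.+1 /\ x r.+1 <= t k.+1.
Hypothesis hy : forall r, h (y r) = h (x r.+1).
Hypothesis g_flat : forall r, g (x r) = g (y r).
Hypothesis h_lim : forall z, z < h (t k.+1) -> exists r, z < h (y r).

(* The defect mass of the branch lives on the gaps [`]y r, x r.+1[], each of
   which collapses to the point [h (y r)]. *)
Lemma msupp_defect_sequence (z : R) : msupp (defect_pushforward mu t c k) z ->
  [\/ z = h (t k), z = h (t k.+1) | exists r, z = h (y r)].
Proof.
move=> zs; have /andP[kz zk] := msupp_defect_bounds inv zs.
have [->|z0] := eqVneq z (h (t k)); first exact: Or31.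
have [->|z1] := eqVneq z (h (t k.+1)); first exact: Or32.
apply: Or33; have zlt : z < h (t k.+1) by rewrite lt_neqAle z1.
have flat r : h (x r) < z < h (y r) -> False.
  move=> zr; have [kx [xr [yx xk]]] := xy r.
  exact: (msupp_defect_flat itm inv mu_atom kn kx xr (le_trans yx xk) (g_flat r) zr) zs.
(* For the least such [r], flatness forbids [h (x r) < z]. If [r = 0] this contradicts
   [z != h (t k)]; otherwise [h (x r)] is the previous [h (y _)], and minimality forbids [z] below
   it. *)
have [r zr rmin] := ex_minnP (h_lim zlt).
case: r => [|r] in zr rmin *.
  by exfalso; apply: (flat 0%N); rewrite zr x0 lt_neqAle eq_sym z0 kz.
exists r; apply/eqP; rewrite eq_le; apply/andP; split; rewrite leNgt; apply/negP => zy.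
  by apply: (flat r.+1); rewrite zr -hy zy.
by have := rmin r zy; rewrite ltnn.
Qed.

End defect_sequence.

(** * The cut set of the stationary map *)

Section bruin_troubetzkoy_cuts.
Context {R : realType} (a b : R).
Hypotheses (a12 : 0 < a < 1 / 2) (root_a : a ^+ 3 - a ^+ 2 - 2 * a + 1 = 0).
Hypothesis bE : b = a ^+ 2.
Context (mu : probability (measurableTypeR R) R).
Hypothesis inv : invariant_probability (BT_map a b) mu.
Hypothesis uniq : forall nu : probability (measurableTypeR R) R,
  invariant_probability (BT_map a b) nu ->
  forall B : set R, measurable B -> nu B = mu B.
Hypothesis mu_atom : nonatomic mu.
Local Notation h := (distr mu).
Local Notation mu1 := (proj1 inv).
Local Notation q := (1 - 2 * a + b).
Local Notation order := (BT_order a12 root_a bE).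
Local Notation g x := (h (x + a) - h x).
Local Notation t := (BT_t a b).
Local Notation c := (BT_c a b).

Let itm : is_ITM 3 t c (BT_map a b) := BT_itm a12 root_a bE.
Let ab := BT_ab root_a bE.
Let aa := BT_aa bE.

Let bc := BT_bc root_a bE.
Let aq := BT_aq root_a bE.

Let q01 : 0 < q < 1.
Proof. by have [? ? ? ? ?] := order; lra. Qed.

(* [x_ r] and [y_ r] are the images of [0] and [b] under the [r]-th iterate of
   the contraction [z |-> a + b * z], which maps the first branch onto its part
   above [a]; the fixed point of this contraction is [1 - a]. *)
Let x_ (r : nat) := (1 - a) * (1 - b ^+ r).
Let y_ (r : nat) := x_ r + b ^+ r.+1.

Let x_S r : x_ r.+1 = a + b * x_ r.
Proof.
rewrite /x_ exprS mulrA bc; move: (b ^+ r) => p.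
rewrite (_ : a + (1 - 2 * a) * (1 - p) = 1 - a - (1 - 2 * a) * p); last by ring.
by rewrite mulrBr mulr1 mulrA [(1 - a) * b]mulrC bc.
Qed.

Let y_S r : y_ r.+1 = a + b * y_ r.
Proof. by rewrite /y_ x_S [b ^+ r.+2]exprS; ring. Qed.

Let x_0 : x_ 0 = 0. Proof. by rewrite /x_ expr0 subrr mulr0. Qed.

Let y_0 : y_ 0 = b. Proof. by rewrite /y_ x_0 add0r expr1. Qed.

Let xy_bounds r : 0 <= x_ r /\ x_ r <= y_ r /\ y_ r <= x_ r.+1 /\ x_ r.+1 <= 1 - a.
Proof.
have [b0 ? ? ? a0] := order.
have xr s : 0 <= x_ s <= 1 - a.
  have p0 : 0 <= b ^+ s <= 1 by rewrite exprn_ge0 ?exprn_ile1 ?ltW//; lra.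
  by rewrite /x_; move: (b ^+ s) p0 => p p0; nra.
have [/andP[x0 _] /andP[_ x1]] := (xr r, xr r.+1).
split => //; split; first by rewrite lerDl exprn_ge0// ltW.
split => //; elim: (r) => [|s IH]; first by rewrite y_0 x_S x_0 mulr0 addr0 ltW.
by rewrite y_S x_S lerD2l ler_pM2l.
Qed.

Let xr01 r : 0 <= x_ r <= 1 - a.
Proof. by have [? [? [? ?]]] := xy_bounds r; lra. Qed.

Let yr01 r : 0 <= y_ r <= 1 - a.
Proof. by have [? [? [? ?]]] := xy_bounds r; lra. Qed.

Let h_shift := distr_BT_shift a12 root_a bE inv uniq mu_atom.

(** [h] turns the contraction [z |-> a + b * z] into [p |-> q + q * p], whose fixed point is [a]
    because [a * q = a - q]; the orbit of 0 gives the closed form. *)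
Let h_x r : h (x_ r) = a * (1 - q ^+ r).
Proof.
elim: r => [|r IH]; first by rewrite x_0 (distr_le0 mu1 mu_atom)// expr0 subrr mulr0.
by rewrite x_S h_shift// IH exprS; move: aq (q ^+ r) => E p; nra.
Qed.

Let h_y r : h (y_ r) = a * (1 - q ^+ r.+1).
Proof.
elim: r => [|r IH].
  have [b0 ? ? ? a0] := order.
  rewrite y_0 (distr_BT_gapE a12 root_a bE inv uniq mu_atom) ?expr1; last lra.
  by rewrite mulrBr aq; ring.
by rewrite y_S h_shift// IH [q ^+ r.+2]exprS; move: aq (q ^+ r.+1) => E p; nra.
Qed.

Let g_shift := BT_gap_shift a12 root_a bE inv uniq mu_atom.

Let g_flat0 := BT_gap_flat a12 root_a bE inv uniq mu_atom.

Let g_flat r : g (x_ r) = g (y_ r).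
Proof.
have [b0 ? ? ? a0] := order.
elim: r => [|r IH]; first by rewrite x_0 y_0 (g_flat0 (x := 0)) ?(g_flat0 (x := b))//; lra.
by rewrite x_S y_S !g_shift// IH.
Qed.

(** The first gap []b, a[] carries the jump [(1 - a) * q]: take [w = q] in the zoom formula, with
    [q + a * q = a] and [h q = q] because [q] lies in [[b, a]]. Each further gap multiplies the jump
    by [q]. *)
Let g_jump r : g (y_ r) < g (x_ r.+1).
Proof.
have [b0 ? ? ? a0] := order; have /andP[q0 _] := q01.
elim: r => [|r IH]; last by rewrite y_S x_S !g_shift// ltrD2l ltr_pM2l// ltrD2r.
rewrite y_0 x_S x_0 mulr0 addr0 (g_flat0 (x := b)); last lra.
have := BT_gap_zoom a12 root_a bE inv uniq mu_atom (w := q) ltac:(lra).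
rewrite (_ : q + a * q = a); last by rewrite aq; ring.
have qa : q < a by rewrite -subr_gt0 -aq mulr_gt0.
rewrite (distr_BT_gapE a12 root_a bE inv uniq mu_atom (y := q)); last lra.
by move=> ->; rewrite ltrDl mulr_gt0//; lra.
Qed.

Local Notation u := (fun r : nat => a * (1 - q ^+ r.+1)).
Local Notation v := (fun r : nat => 2 * a - b - (a - b) * q ^+ r.+1).
Local Notation rho := (defect_pushforward mu t c).
Local Notation Cdef := (defect_cut_set mu 3 t c).

Let h0 : h 0 = 0. Proof. exact: distr_le0 mu1 mu_atom _ (lexx 0). Qed.

Let h1 : h 1 = 1. Proof. exact: distr_ge1 mu1 _ (lexx 1). Qed.

Let h_t1 := distr_BT_t1 a12 root_a bE inv uniq mu_atom.
Let h_t2 := distr_BT_t2 a12 root_a bE inv uniq mu_atom.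
Let h_zoom := distr_BT_zoom a12 root_a bE inv uniq mu_atom.

Let h_zoom_y r : h (1 - a + a * y_ r) = v r.
Proof.
have [b0 ? ? ? a0] := order; have := yr01 r => y1.
rewrite h_zoom; last lra.
by rewrite h_y; move: (q ^+ r.+1) => p; have := aa; nra.
Qed.

(** Translation by [b = a * a] on the second branch is, before zooming, translation by [a] on the
    first, so the defect is copied with factor [1 - a]. *)
Let g_zoom (z : R) : 0 <= z <= 1 - a ->
  h (1 - a + a * z + b) - h (1 - a + a * z) = (1 - a) * g z.
Proof.
have [b0 ? ? ? a0] := order => z1.
rewrite (_ : 1 - a + a * z + b = 1 - a + a * (z + a)); last by rewrite mulrDr aa; ring.
by rewrite !h_zoom; [ring|lra|lra].
Qed.

Let zoom_bounds r : 1 - a <= 1 - a + a * x_ r /\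
  1 - a + a * x_ r <= 1 - a + a * y_ r /\
  1 - a + a * y_ r <= 1 - a + a * x_ r.+1 /\ 1 - a + a * x_ r.+1 <= 1 - b.
Proof.
have [b0 ? ? ? a0] := order; have [? [? [? ?]]] := xy_bounds r.
have -> : 1 - b = 1 - a + a * (1 - a) by rewrite mulrBr aa; ring.
by rewrite lerDl !lerD2l !ler_pM2l// mulr_ge0// ltW.
Qed.

Let u_bounds r : 0 < u r < a.
Proof.
have [b0 ? ? ? a0] := order; have /andP[q0 q1] := q01.
have : 0 < q ^+ r.+1 < 1 by rewrite exprn_gt0// exprn_ilt1// ltW.
by move: (q ^+ r.+1) => p p01; nra.
Qed.

Let v_bounds r : a < v r < 2 * a - b.
Proof.
have [b0 ? ? ? a0] := order; have /andP[q0 q1] := q01.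
have : 0 < q ^+ r.+1 < 1 by rewrite exprn_gt0// exprn_ilt1// ltW.
by move: (q ^+ r.+1) => p p01; nra.
Qed.

Let power_lt (e : R) : 0 < e -> exists r, q ^+ r.+1 < e.
Proof.
have /andP[q0 q1] := q01 => e0; have [r re] := @expr_small _ q e ltac:(lra) e0.
exists r; apply: le_lt_trans re; rewrite exprS ler_piMl ?exprn_ge0//; exact: ltW.
Qed.

Let h_yx r : h (y_ r) = h (x_ r.+1).
Proof. by rewrite h_y h_x. Qed.

Let h_zoom_yx r : h (1 - a + a * y_ r) = h (1 - a + a * x_ r.+1).
Proof.
have [b0 ? ? ? a0] := order; have ? := yr01 r; have ? := xr01 r.+1.
by rewrite !h_zoom ?h_yx//; lra.
Qed.

Let g_zoom_flat r : h (1 - a + a * x_ r + b) - h (1 - a + a * x_ r) =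
  h (1 - a + a * y_ r + b) - h (1 - a + a * y_ r).
Proof. by rewrite !g_zoom// g_flat. Qed.

Let g_zoom_jump r : h (1 - a + a * y_ r + b) - h (1 - a + a * y_ r) <
  h (1 - a + a * x_ r.+1 + b) - h (1 - a + a * x_ r.+1).
Proof.
have [b0 ? ? ? a0] := order.
by rewrite !g_zoom// ltr_pM2l//; lra.
Qed.

Lemma BT_msupp_defect0 (z : R) : msupp (rho 0%N) z -> [\/ z = 0, z = a | range u z].
Proof.
have [b0 ? ? ? a0] := order => zs.
have lim w : w < h (t 1%N) -> exists r, w < h (y_ r).
  rewrite /BT_t/= h_t1 => wa.
  (* The threshold solves [w < a * (1 - q ^ (r + 1))] for the power of [q]. *)
  have e0 : 0 < (a - w) / a by rewrite divr_gt0 ?subr_gt0.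
  have [r] := power_lt e0; rewrite ltr_pdivlMr// => rw; exists r; rewrite h_y.
  by rewrite mulrBr mulr1 mulrC; move: rw; rewrite mulrC; lra.
have := msupp_defect_sequence (k := 0%N) itm inv mu_atom isT x_0 xy_bounds h_yx g_flat lim zs.
rewrite /BT_t/= h0 h_t1 => -[->|->|[r ->]]; [exact: Or31|exact: Or32|apply: Or33].
by exists r => //; rewrite h_y.
Qed.

Lemma BT_msupp_defect1 (z : R) : msupp (rho 1%N) z ->
  [\/ z = a, z = 2 * a - b | range v z].
Proof.
have [b0 ? ? ? a0] := order => zs.
have lim w : w < h (t 2%N) -> exists r, w < h (1 - a + a * y_ r).
  rewrite /BT_t/= h_t2 => wa; have ab0 : 0 < a - b by lra.
  have e0 : 0 < (2 * a - b - w) / (a - b) by rewrite divr_gt0 ?subr_gt0.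
  have [r] := power_lt e0; rewrite ltr_pdivlMr// => rw; exists r; rewrite h_zoom_y.
  by move: rw; rewrite mulrC; lra.
have x0E : 1 - a + a * x_ 0 = t 1%N by rewrite x_0 mulr0 addr0.
have := msupp_defect_sequence (k := 1%N) (x := fun r => 1 - a + a * x_ r)
  (y := fun r => 1 - a + a * y_ r)
  itm inv mu_atom isT x0E zoom_bounds h_zoom_yx g_zoom_flat lim zs.
rewrite /BT_t/= h_t1 h_t2 => -[->|->|[r ->]]; [exact: Or31|exact: Or32|apply: Or33].
by exists r => //; rewrite h_zoom_y.
Qed.

(** The image [[0, b[] of the last branch is reached from no other branch, so the defect has no
    increment. Flatness excludes only interior values; the two remaining ones are branch cuts
    anyway. *)
Lemma BT_msupp_defect2 (z : R) : msupp (rho 2%N) z -> z = 2 * a - b \/ z = 1.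
Proof.
have [b0 ? ? ? a0] := order => zs.
have := msupp_defect_bounds inv zs; rewrite /BT_t/= h_t2 h1 => /andP[z0 z1].
have [->|n0] := eqVneq z (2 * a - b); first by left.
have [->|n1] := eqVneq z 1; first by right.
exfalso; apply: (msupp_defect_flat (p := 1 - b) (q := 1) itm inv mu_atom (_ : 2 < 3)%N) zs => //.
- by rewrite /BT_t/=; lra.
- rewrite /BT_c/= (_ : 1 - b + (b - 1) = 0); last by ring.
  rewrite (_ : 1 + (b - 1) = b); last by ring.
  by rewrite h0 h1 h_t2 (distr_BT_gapE a12 root_a bE inv uniq mu_atom); [ring|lra].
- by rewrite h_t2 h1 !lt_neqAle z0 z1 n1 eq_sym n0.
Qed.

Lemma BT_cut_u r : [/\ msupp (rho 0%N) (u r), active_gap_cut mu 3 t c (u r)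
  & h (t 0%N) < u r < h (t 1%N)].
Proof.
have [kx [xy [yx xk]]] := xy_bounds r; have ky := le_trans kx xy.
split; last by rewrite /BT_t/= h0 h_t1.
- rewrite -h_y.
  exact: (msupp_defect_jump (k := 0%N) itm inv mu_atom isT ky yx xk (h_yx r) (g_jump r)).
- rewrite -h_y.
  exact: (active_gap_cut_jump (n := 3%N) (t := t) (c := c) (k := 0%N)
    inv mu_atom isT ky yx xk (h_yx r) (g_jump r)).
Qed.

Lemma BT_cut_v r : [/\ msupp (rho 1%N) (v r), active_gap_cut mu 3 t c (v r)
  & h (t 1%N) < v r < h (t 2%N)].
Proof.
have [kx [xy [yx xk]]] := zoom_bounds r; have ky := le_trans kx xy.
split; last by rewrite /BT_t/= h_t1 h_t2.
- rewrite -h_zoom_y.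
  exact: (msupp_defect_jump (k := 1%N) itm inv mu_atom isT ky yx xk (h_zoom_yx r) (g_zoom_jump r)).
- rewrite -h_zoom_y.
  exact: (active_gap_cut_jump (n := 3%N) (t := t) (c := c) (k := 1%N)
    inv mu_atom isT ky yx xk (h_zoom_yx r) (g_zoom_jump r)).
Qed.

Lemma BT_defect_cut_set :
  Cdef = [set 0; 1; a; 2 * a - b] `|` range u `|` range v.
Proof.
have ht k e : (k <= 3)%N -> h (t k) = e -> Cdef e by move=> k3 <-; left; exists k.
have Cu r : Cdef (u r) by right; exists 0%N => //; have [] := BT_cut_u r.
have Cv r : Cdef (v r) by right; exists 1%N => //; have [] := BT_cut_v r.
apply/seteqP; split => z; last first.
  move=> [[[[[->|->]|->]|->]|[r _ <-]]|[r _ <-]].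
  - exact: (ht 0%N _ isT h0).
  - exact: (ht 3%N _ isT h1).
  - exact: (ht 1%N _ isT h_t1).
  - exact: (ht 2%N _ isT h_t2).
  - exact: Cu.
  - exact: Cv.
move=> [[k + <-]|[k + zs]].
  case: k => [|[|[|[|//]]]] _; rewrite /BT_t/=; left; left.
  - by rewrite h0; left; left; left.
  - by rewrite h_t1; left; right.
  - by rewrite h_t2; right.
  - by rewrite h1; left; left; right.
case: k zs => [|[|[|//]]] zs _.
- have [->|->|?] := BT_msupp_defect0 zs; last by left; right.
    by left; left; left; left; left.
  by left; left; left; right.
- have [->|->|?] := BT_msupp_defect1 zs; last by right.
    by left; left; left; right.
  by left; left; right.
- have [->|->] := BT_msupp_defect2 zs; first by left; left; right.
  by left; left; left; left; right.
Qed.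

Lemma BT_u_inj : injective u.
Proof.
have [b0 ? ? ? a0] := order; have /andP[q0 q1] := q01.
move=> r s /(mulfI (lt0r_neq0 a0)) /(congr1 (fun z => 1 - z)).
rewrite !subKr => E; apply: succn_inj.
exact: (ieexprIn q0 (negbT (lt_eqF q1)) E).
Qed.

End bruin_troubetzkoy_cuts.

(** * Infinitely many essential cuts, and the theorem *)

Lemma infinite_range {T : choiceType} (f : nat -> T) : injective f -> infinite_set (range f).
Proof.
move=> finj fin; apply: infinite_nat.
by apply: (sub_finite_set _ (finite_preimage (in2W finj) fin)) => r _; exists r.
Qed.

(** A finite [F] misses some cut; the component of its complement around that cut is a
    neighbourhood, on which a single translation would contradict essentiality. *)
Lemma not_finitely_many_translations_essential {R : realType} (f : R -> R) (u : nat -> R) :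
  injective u -> (forall r, essential_cut f (u r)) -> ~ finitely_many_translations f.
Proof.
move=> uinj uess [F [finF FC FT]].
have [r nFr] : exists r, ~ F (u r).
  apply: contrapT => nex; apply: (infinite_range uinj).
  apply: sub_finite_set finF => _ [r _ <-]; apply: contrapT => nF.
  by apply: nex; exists r.
have [/andP[u0 u1] ness] := uess r.
have Cur : (unitC `\` F) (u r) by split => //; rewrite /unitC/= in_itv/= !ltW.
have [d fd] := FT _ Cur; apply: ness.
exists (connected_component (unitC `\` F) (u r)), d; split => //.
have oF : open (`]0, 1[%classic `&` ~` F : set R).
  apply: openI => //; apply: closed_openC.
  exact: (accessible_finite_set_closed.1 (hausdorff_accessible (@Rhausdorff R))).
have Fur : (`]0, 1[%classic `&` ~` F) (u r) by split; rewrite //= in_itv/= u0.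
have [e e0 eF] := nbhs_itvoo (open_nbhs_nbhs (conj oF Fur)).
have ur : `](u r - e), (u r + e)[%classic (u r) by rewrite /= in_itv/=; lra.
apply: filterS (open_nbhs_nbhs (conj (@open_itvoo R _ _) ur)).
apply: connected_component_max => //.
- by move=> y /eF[y01 nFy]; split => //; move: y01; rewrite /unitC/= !in_itv/=; lra.
- by apply/connected_intervalP/interval_is_interval.
Qed.

Theorem theorem1p1 (R : realType) :
  (forall (n : nat) (t c : nat -> R) (S : R -> R)
      (mu : probability (measurableTypeR R) R) (X0 : set R) (ustar : R),
    is_ITM n t c S ->
    invariant_probability S mu ->
    nonatomic mu ->
    bijectivity_domain mu S X0 ->
    unitC ustar ->
    let T := canonical_model mu n t S X0 ustar in
    let Cdef := defect_cut_set mu n t c in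
    (finite_set Cdef -> finite_IET_ae T) /\
    (lebesgue_measure Cdef = 0%E -> countable_IET T)) /\
  (forall (alpha beta q0 : R)
      (mu : probability (measurableTypeR R) R) (X0 : set R) (ustar : R),
    0 < alpha < 1 / 2 ->
    alpha ^+ 3 - alpha ^+ 2 - 2 * alpha + 1 = 0 ->
    beta = alpha ^+ 2 ->
    q0 = (1 - alpha) ^+ 2 ->
    let n := 3%N in
    let t := BT_t alpha beta in
    let c := BT_c alpha beta in
    let S := BT_map alpha beta in
    invariant_probability S mu ->
    (forall nu : probability (measurableTypeR R) R,
       invariant_probability S nu ->
       forall B : set R, measurable B -> nu B = mu B) ->
    nonatomic mu ->
    bijectivity_domain mu S X0 ->
    unitC ustar ->
    let T := canonical_model mu n t S X0 ustar in
    let Cdef := defect_cut_set mu n t c in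
    let u (r : nat) := alpha * (1 - q0 ^+ r.+1) in
    let v (r : nat) := 2 * alpha - beta - (alpha - beta) * q0 ^+ r.+1 in
    [/\ Cdef = [set 0; 1; alpha; 2 * alpha - beta] `|` range u `|` range v,
        countable Cdef /\ infinite_set Cdef,
        lebesgue_measure Cdef = 0%E,
        forall r : nat,
          (active_gap_cut mu n t c (u r) /\ essential_cut T (u r)) /\
          (active_gap_cut mu n t c (v r) /\ essential_cut T (v r))
      & countable_IET T /\ ~ finitely_many_translations T]).
Proof.
split=> [n t c S mu X0 ustar itm inv mu_atom dom ustar01 T Cdef|].
  split; first exact: finite_IET_model itm inv mu_atom dom ustar01.
  exact: countable_IET_model itm inv mu_atom dom ustar01.
move=> a b q0 mu X0 ustar a12 root_a bE q0E n t c S inv uniq mu_atom dom ustar01.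
(* [(1 - a) ^ 2] is replaced by the form, linear in [a] and [b], in which the ratio [q] appears
   throughout. *)
have {}q0E : q0 = 1 - 2 * a + b by rewrite q0E bE; ring.
rewrite {}q0E => T Cdef u v.
have itm : is_ITM n t c S := BT_itm a12 root_a bE.
have CdefE : Cdef = [set 0; 1; a; 2 * a - b] `|` range u `|` range v.
  exact (BT_defect_cut_set a12 root_a bE inv uniq mu_atom).
have cCdef : countable Cdef.
  have -> : Cdef = \bigcup_(i in [set: 'I_3])
      nth setT [:: [set 0; 1; a; 2 * a - b]; range u; range v] i.
    rewrite CdefE; apply/seteqP; split => z.
      by case=> [[?|?]|?]; [exists ord0|exists (inord 1)|exists (inord 2)]; rewrite //= inordK.
    by case=> -[[|[|[|//]]] ?] _ /= ?; [left; left|left; right|right].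
  apply: bigcup_countable => [|i _]; first exact: countableP.
  case: i => -[|[|[|//]]] /= _.
  - by apply: finite_set_countable; rewrite !finite_setU; do !split; exact: finite_set1.
  - by apply: sub_countable (card_image_le _ _) _; exact: countableP.
  - by apply: sub_countable (card_image_le _ _) _; exact: countableP.
have Cdef0 : lebesgue_measure Cdef = 0%E by exact: countable_lebesgue_measure0.
have u_inj : injective u by exact: BT_u_inj a12 root_a bE.
have cut_u r := BT_cut_u a12 root_a bE inv uniq mu_atom r.
have cut_v r := BT_cut_v a12 root_a bE inv uniq mu_atom r.
have ess_u r : essential_cut T (u r).
  have [us _ ub] := cut_u r.
  exact: (essential_of_msupp ustar itm inv mu_atom dom (k := 0%N) isT ub us).
have ess_v r : essential_cut T (v r).
  have [vs _ vb] := cut_v r.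
  exact: (essential_of_msupp ustar itm inv mu_atom dom (k := 1%N) isT vb vs).
split => //.
- split => // fin; apply: (infinite_range u_inj); apply: sub_finite_set fin.
  by rewrite CdefE => z uz; left; right.
- by move=> r; split; split => //; [have [] := cut_u r|have [] := cut_v r].
- split; first exact: countable_IET_model itm inv mu_atom dom ustar01 Cdef0.
  exact: not_finitely_many_translations_essential u_inj ess_u.
Qed.
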